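(* Let the data $Z$, $(G^i,T^i)$, $\mu$, $W=W_0\times\cdots\times W_k$, $F_1,\dots,F_k$, $U$, $c$, $(X^i_j)$, $(\mathcal{E}^i_j)$ satisfy all the assumptions (functional data, parametric model, domination, observations) listed in the context. Let $W^*\subset W$ be the set of minimizers over $W$ of $$\lambda(w)=E\left(c\left(T^1,H(w,G^1)\right)\right),$$ and, with $m=\inf_{1\le i\le n}m^i$, let $w_n^m$ be a minimizer over $W$ of the empirical error $$\lambda_n^m(w)=\frac1n\sum_{i=1}^n c\left(t^i,\,U\left(w_0,\frac{1}{m^i}\sum_{j=1}^{m^i}F_1(w_1,x^i_j)y^i_j,\ \dots,\ \frac{1}{m^i}\sum_{j=1}^{m^i}F_k(w_k,x^i_j)y^i_j\right)\right),$$ where $t^i$, $x^i_j$, $g^i$, $\varepsilon^i_j$ are the realizations of $T^i$, $X^i_j$, $G^i$, $\mathcal{E}^i_j$ and $y^i_j=g^i(x^i_j)+\varepsilon^i_j$. Then, $P$-almost surely, $$\lim_{n\to\infty}\lim_{m\to\infty}d(w_n^m,W^* )=0.$$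
   Context: All random quantities are defined on a probability space $(\Omega,\mathcal{A},P)$; $E$ is expectation; $d$ is the distance on $W$ and $d(w,W^* )$ is the distance from a point to a set. Functional data: (1) $Z$ is a compact subset of $\mathbb{R}^u$. (2) $(G^i,T^i)_{i\in\mathbb{N}}$ is an i.i.d. sequence of random elements with values in $C(Z,\mathbb{R})\times\mathbb{R}^o$, where $C(Z,\mathbb{R})$ is the space of continuous real functions on $Z$, with its Borel sigma algebra. Parametric model: $\mu$ is a finite positive Borel measure on $Z$, and for $w=(w_0,\dots,w_k)\in W=W_0\times\cdots\times W_k$ and $g\in C(Z,\mathbb{R})$, $$H(w,g)=U\left(w_0,\int F_1(w_1,x)g(x)\,d\mu(x),\dots,\int F_k(w_k,x)g(x)\,d\mu(x)\right).$$ It is assumed that: (1) for $0\le l\le k$, $W_l$ is a compact subset of $\mathbb{R}^{v_l}$; (2) for $1\le l\le k$, $F_l$ is a function from $W_l\times Z$ to $\mathbb{R}$ such that (a) $F_l(\cdot,x)$ is continuous for each $x\in Z$, (b) $F_l(w_l,\cdot)$ is measurable for each $w_l\in W_l$, (c) there is a measurable function $d_l\in L^p(\mu)$ (with $p\ge1$) such that $|F_l(w,x)|\le d_l(x)$ for all $w\in W_l$ and $x\in Z$; (3) $U$ is a uniformly continuous function from $W_0\times\mathbb{R}^k$ to $\mathbb{R}^o$; (4) $U$ is bounded. Error and domination: $c$ is a distance on $\mathbb{R}^o$ (it need not really be a distance: it can be any continuous positive function on $\mathbb{R}^o\times\mathbb{R}^o$). There is a positive function $c_{\max}$ from $\mathbb{R}^o$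 to $\mathbb{R}$ such that (1) $c(t,H(w,g))\le c_{\max}(t)$ for all $w\in W$, $g\in C(Z,\mathbb{R})$ and $t\in\mathbb{R}^o$, and (2) $E(c_{\max}(T^1))<\infty$. Observations: (1) $(X^i_j)_{i\in\mathbb{N},\,j\in\mathbb{N}}$ is a sequence of independent sequences of random variables defined on $(\Omega,\mathcal{A},P)$ with values in $Z$. (2) All $X^i_j$ are identically distributed and the induced probability measure on $Z$ is $\mu$. (3) $(\mathcal{E}^i_j)_{i\in\mathbb{N},\,j\in\mathbb{N}}$ is a sequence of independent sequences of random variables defined on $(\Omega,\mathcal{A},P)$ with values in $\mathbb{R}$. (4) For all $i$, $(\mathcal{E}^i_j)_{j\in\mathbb{N}}$ and $(X^i_j)_{j\in\mathbb{N}}$ are independent. (5) $E(\mathcal{E}^i_j)=0$ and $E(|\mathcal{E}^i_j|^q)<\infty$, where $q$ is the conjugate exponent of the $p$ of assumption (2)(c) on the parametric model. For each $i$, only the first $m^i$ observation pairs $(x^i_j,y^i_j)$, $1\le j\le m^i$, are known.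
   Formalization: For each i the q-th moments of the noise variables are assumed bounded uniformly in j (automatic if identically distributed in j), since finiteness of each alone makes the claim false; the inner limit in m, which need not exist, is read as an upper limit. *)

(* Defs.v *)
(* MathComp-Analysis, over an arbitrary R : realType. *)
From HB Require Import structures.
From mathcomp Require Import all_boot all_order all_algebra.
From mathcomp Require Import all_classical all_reals all_analysis.

Set Implicit Arguments.
Unset Strict Implicit.
Unset Printing Implicit Defensive.

Import Order.TTheory GRing.Theory Num.Theory.
Import numFieldNormedType.Exports.

Local Open Scope classical_set_scope.
Local Open Scope ring_scope.

(* The library has both structures on a product, but not their join. *)
HB.instance Definition _ (T1 T2 : ptopologicalType) :=
  Pointed.on (T1 * T2)%type.

Definition Borel (T : ptopologicalType) : Type :=
  g_sigma_algebraType (@open T).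
HB.instance Definition _ (T : ptopologicalType) :=
  Measurable.on (Borel T).

(* C(Z, R) with the topology of uniform convergence on Z, i.e. that of the sup
   norm when Z is compact.  An element is represented by a function on the whole
   space; the topology, hence its Borel sigma-algebra, does not distinguish two
   functions that agree on Z. *)
Definition cont_on (R : realType) (u : nat) (Z : set 'rV[R]_u) : Type :=
  [set g : {uniform` Z -> R} | {within Z, continuous (g : 'rV[R]_u -> R)}].

Section cont_on_instances.
Variables (R : realType) (u : nat) (Z : set 'rV[R]_u).

HB.instance Definition _ := Uniform.on (cont_on Z).

Lemma cont_on_cst0 :
  (cst 0 : {uniform` Z -> R}) \in
  [set g : {uniform` Z -> R} | {within Z, continuous (g : 'rV[R]_u -> R)}].
Proof. by apply/mem_set => x; exact: cvg_cst. Qed.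

HB.instance Definition _ :=
  isPointed.Build (cont_on Z) (exist _ (cst 0) cont_on_cst0).

Definition cont_on_fun (g : cont_on Z) : 'rV[R]_u -> R := sval g.

End cont_on_instances.

Coercion cont_on_fun : cont_on >-> Funclass.

Section probability_notions.
Context d (Omega : measurableType d) (R : realType) (P : probability Omega R).

Definition mutually_independent (I : eqType) d' (T : measurableType d')
    (X : I -> Omega -> T) : Prop :=
  forall (J : seq I) (B : I -> set T), uniq J ->
    (forall i, i \in J -> measurable (B i)) ->
    (P [set omega | forall i, i \in J -> B i (X i omega)] =
     \prod_(i <- J) P (X i @^-1` B i))%E.

Definition identically_distributed (I : Type) d' (T : measurableType d')
    (X : I -> Omega -> T) : Prop :=
  forall (i j : I) (B : set T), measurable B ->
    P (X i @^-1` B) = P (X j @^-1` B).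

Definition family_sigma_algebra (I : Type) d' (T : measurableType d')
    (X : I -> Omega -> T) : set (set Omega) :=
  <<s \bigcup_i preimage_set_system [set: Omega] (X i) measurable >>.

Definition independent_families (I1 I2 : Type) d1 (T1 : measurableType d1)
    d2 (T2 : measurableType d2) (X : I1 -> Omega -> T1) (Y : I2 -> Omega -> T2) :
    Prop :=
  forall A B, family_sigma_algebra X A -> family_sigma_algebra Y B ->
    P (A `&` B) = (P A * P B)%E.

End probability_notions.

Definition minimizers (T : Type) d (V : porderType d) (W : set T) (f : T -> V) :
    set T :=
  [set w | W w /\ forall w', W w' -> (f w <= f w')%O].

Section model.
Variables (R : realType) (u o k : nat) (v : 'I_k.+1 -> nat).

(* A parameter w = (w_0, ..., w_k) is the concatenation of its blocks
   w_l = submxrow w l; F is indexed by l < k, F_(l+1) taking the block w_(l+1).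
   The distance on W is that of the norm of 'rV[R]_(\sum_l v l), i.e. the
   product sup distance. *)
Notation param := 'rV[R]_(\sum_l v l).

Variables (F : forall l : 'I_k, 'rV[R]_(v (lift ord0 l)) -> 'rV[R]_u -> R)
          (U : 'rV[R]_(v ord0) -> 'rV[R]_k -> 'rV[R]_o).

Definition param_set (Wl : forall l, set 'rV[R]_(v l)) : set param :=
  [set w | forall l, Wl l (submxrow w l)].

Definition model (Z : set 'rV[R]_u)
    (mu : {measure set (Borel 'rV[R]_u) -> \bar R})
    (w : param) (g : 'rV[R]_u -> R) : 'rV[R]_o :=
  U (submxrow w ord0)
    (\row_l \int[mu]_(x in Z) (F (submxrow w (lift ord0 l)) x * g x)).

Definition empirical_model (m : nat) (w : param)
    (x : nat -> 'rV[R]_u) (y : nat -> R) : 'rV[R]_o :=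
  U (submxrow w ord0)
    (\row_l (m%:R^-1 * \sum_(j < m) F (submxrow w (lift ord0 l)) (x j) * y j)).

Definition empirical_error (c : 'rV[R]_o -> 'rV[R]_o -> R)
    (n : nat) (m : nat -> nat) (t : nat -> 'rV[R]_o)
    (x : nat -> nat -> 'rV[R]_u) (y : nat -> nat -> R) (w : param) : R :=
  n%:R^-1 * \sum_(i < n) c (t i) (empirical_model (m i) w (x i) (y i)).

End model.

(* The upper limit of f m, for sample sizes m = (m^i)_i, as the infimum of m^i
   over the first n indices i tends to infinity. *)
Definition limsup_sizes (R : realType) (n : nat) (f : (nat -> nat) -> \bar R) :
    \bar R :=
  ereal_inf [set ereal_sup (f @` [set m | forall i, (i < n)%N -> (M <= m i)%N])
            | M in [set: nat]].

(* Main.v *)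
(** For fixed n the inner limit replaces the empirical features
    (1/m) sum_j F_l(w_l, X_j) (g(X_j) + E_j) by the integrals of F_l(w_l, .) g,
    uniformly in w; the outer limit is a uniform law of large numbers for the
    losses c(T^i, H(w, G^i)), after which near-minimizers of a continuous
    function on a compact set are close to its minimizers.

    Both uniform laws follow by Jennrich's bracketing from one strong law, for
    psi(X_j) e_j with psi integrable, X_j identically distributed, and e_j >= 0
    independent of X_j with E(e_j^r) bounded for some r > 1 (e_j = 1, or the
    positive and negative parts of the noise).  The e_j need not be identically
    distributed, but Etemadi's argument still applies: along k_n = floor(a^n),
    truncation at a^n costs a summable series, and monotonicity of the partial
    sums of nonnegative variables fills the gaps.  No independence of G^i from
    (X^i, E^i) is available, so the first law has to hold simultaneously for
    all continuous g: it is proved for indicators of countably many small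
    cells, whose linear combinations approximate every g uniformly on Z. *)
Require Import Defs.
From HB Require Import structures.
From mathcomp Require Import all_boot all_order all_algebra.
From mathcomp Require Import all_classical all_reals all_analysis.
From mathcomp Require Import measurable_realfun ess_sup_inf ring lra.

Set Implicit Arguments.
Unset Strict Implicit.
Unset Printing Implicit Defensive.

Import Order.TTheory GRing.Theory Num.Theory.
Import numFieldNormedType.Exports.

Local Open Scope classical_set_scope.
Local Open Scope ring_scope.

(** * A strong law of large numbers *)

(** The integrability available shapes the estimates. [psi] is only integrable, and the noise only
    has a moment of order [q], which is close to [1] when [p] is large; as [p] is finite, [q > 1],
    and the exponent used is [r = min(q, 2)]. Second moments of the product truncated at level [t]
    must therefore cost a single power of [psi] once summed over the levels. This comes from
    bounding [min(x y, t)^2] by [min(t^2, t^(2-r) x^r) (1 + y^r)]: independence separates the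
    factors, and the first one, divided by [t] and summed over [t = a^n], is at most a constant
    times [x]. The condition [r > 1] makes that series converge and makes the truncation bias vanish
    uniformly in [j]. The second constraint concerns null sets: parameters and functions [g] range
    over uncountable sets, so each exceptional set is built from countably many choices (grid
    ratios, tolerances [1/(i+1)], bracket centres, cells, sample indices). The thresholds on the
    sizes [m] may then depend on the realization and on [n], as the iterated limit allows. *)

(** By Tonelli the series of the [f n] has a finite integral, hence is finite almost everywhere, and
    its terms tend to [0]. This plays the role of Chebyshev's inequality combined with
    Borel-Cantelli. *)
Lemma ae_cvg0_of_summable d (Omega : measurableType d) (R : realType)
    (P : {measure set Omega -> \bar R}) (f : nat -> Omega -> R) (C : R) :
  (forall n, measurable_fun setT (f n)) -> (forall n x, 0 <= f n x) ->
  (forall N, (\sum_(n < N) \int[P]_x (f n x)%:E <= C%:E)%E) ->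
  {ae P, forall x, f ^~ x @ \oo --> 0}.
Proof.
move=> mf f0 fC.
have mf' n : measurable_fun setT (fun x => (f n x)%:E) by exact/measurable_EFinP.
have intF : (\int[P]_x (\sum_(n <oo) (f n x)%:E) < +oo)%E.
  rewrite (@integral_nneseries _ _ _ P setT measurableT (fun n x => (f n x)%:E))//=.
    apply: (@le_lt_trans _ _ C%:E); last exact: ltry.
    apply: lime_le.
      by apply: is_cvg_nneseries => n _ _; apply: integral_ge0 => x _; rewrite lee_fin.
    by apply: nearW => N; rewrite big_mkord.
  by move=> n x _; rewrite lee_fin.
have F0 x : (0 <= \sum_(n <oo) (f n x)%:E)%E.
  by apply: nneseries_ge0 => n _ _; rewrite lee_fin.
have mF : measurable_fun setT (fun x => \sum_(n <oo) (f n x)%:E)%E.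
  rewrite (_ : (fun x => _) = fun x => (\sum_(n <oo | n \in xpredT) (f n x)%:E)%E)//.
  by apply: ge0_emeasurable_sum => // n x _ _; rewrite lee_fin.
have iF : P.-integrable setT (fun x => \sum_(n <oo) (f n x)%:E)%E.
  apply/integrableP; split => //.
  by under eq_integral => x _ do rewrite gee0_abs//.
have := integrable_ae measurableT iF.
apply: filterS => x /(_ I) Fx.
apply: cvg_series_cvg_0; apply: nondecreasing_is_cvgn.
  by apply: nondecreasing_series => n _ _; exact: f0.
exists (fine (\sum_(n <oo) (f n x)%:E)) => _ [n _ <-] /=.
rewrite -lee_fin fineK// /series/= -sumEFin.
by apply: nneseries_lim_ge => i _ _; rewrite lee_fin.
Qed.

Lemma expr1D_ge (R : realType) (h : R) n : 0 <= h -> 1 + n%:R * h <= (1 + h) ^+ n.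
Proof.
move=> h0; elim: n => [|n IH]; first by rewrite mul0r addr0 expr0.
rewrite exprS -natr1.
have : (1 + h) * (1 + n%:R * h) <= (1 + h) * (1 + h) ^+ n.
  by rewrite ler_pM2l//; lra.
apply: le_trans.
have : 0 <= n%:R * h * h by rewrite !mulr_ge0.
by move=> ?; nra.
Qed.

Section etemadi_sandwich.
Variables (R : realType) (V e : nat -> R) (M : R).
Hypotheses (V0 : forall j, 0 <= V j) (e0 : forall j, 0 <= e j <= M).
Let D m := \sum_(j < m) (V j - e j).
Let grid (N n : nat) : R := (1 + N.+1%:R^-1) ^+ n.
Hypothesis Dgrid : forall N,
  D (Num.truncn (grid N n)) / grid N n @[n --> \oo] --> 0.

(** Each new term [V j] is nonnegative and each compensator [e j] is at most [M], so [D] cannot drop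
    faster than [M] per step. *)
Let D_diff a b : (a <= b)%N -> D a - (b%:R - a%:R) * M <= D b.
Proof.
move=> /subnKC <-; elim: (b - a)%N => [|k IH]; first by rewrite addn0 subrr mul0r subr0.
have DS : D (a + k).+1 = D (a + k) + (V (a + k) - e (a + k)) by rewrite /D big_ord_recr.
rewrite addnS DS -natr1.
have := V0 (a + k); have /andP[_] := e0 (a + k); rewrite natrD in IH *; lra.
Qed.

Let grid_gt0 N n : 0 < grid N n.
Proof. by rewrite exprn_gt0// ltr_wpDr. Qed.

Let grid_mono N a b : (a <= b)%N -> grid N a <= grid N b.
Proof. by move=> ab; rewrite ler_weXn2l// lerDl. Qed.

Let grid_unbounded N (x : R) : exists n, x < grid N n.
Proof.
have N0 : 0 < N.+1%:R^-1 :> R by rewrite invr_gt0.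
exists (Num.truncn (`|x| * N.+1%:R)).+1.
apply: lt_le_trans (expr1D_ge _ (ltW N0)).
have := truncnS_gt (`|x| * N.+1%:R).
rewrite -(ltr_pM2r N0) mulfK ?pnatr_eq0// => /(le_lt_trans (ler_norm _)) h.
by rewrite ltr_wpDl.
Qed.

(** Between consecutive grid points [ka <= m <= kb], [D_diff] bounds [D m] below through [D ka] and
    above through [D kb], with an error of [M] times the gap. The gap is about [m / N.+1], hence the
    need for every ratio [1 + N.+1%:R^-1]. *)
Lemma etemadi_sandwich : D m / m%:R @[m --> \oo] --> 0.
Proof.
have M0 : 0 <= M by have /andP[] := e0 0; exact: le_trans.
apply/cvgr0Pnorm_le => eps eps0.
(* This ratio makes the gap error [m * M / N.+1] at most [m * eps / 4]. *)
pose N := Num.truncn (4 * M / eps).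
have NM : M * N.+1%:R^-1 <= eps / 4.
  rewrite ler_pdivrMr// mulrC; have := truncnS_gt (4 * M / eps).
  rewrite ltr_pdivrMr// -/N; lra.
have [/= n0 _ Hn0] := iffLR (cvgr0Pnorm_le _) (Dgrid N) (eps / 8) (divr_gt0 eps0 (ltr0n _ 8)).
(* The first summand pushes the grid index of [m] beyond [n0]; the second gives
   [M <= m * (eps / 4)], which absorbs the rounding of [grid N n] to an integer. *)
pose m0 := (Num.truncn (grid N n0 + 4 * M / eps)).+1.
near=> m.
have m0m : (m0 <= m)%N by near: m; exists m0.
have mgt : grid N n0 + 4 * M / eps < m%:R.
  by apply: lt_le_trans (truncnS_gt _) _; rewrite ler_nat.
have M4 : 0 <= 4 * M / eps by rewrite divr_ge0 ?mulr_ge0// ltW.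
have m_gt0 : 0 < m%:R :> R.
  by apply: le_lt_trans mgt; rewrite addr_ge0// ltW.
have Mm : M <= m%:R * (eps / 4).
  have : 4 * M / eps <= m%:R by have := grid_gt0 N n0; lra.
  by rewrite ler_pdivrMr//; lra.
have [n /andP[n0n /andP[gn gn1]]] : exists n, [&& (n0 <= n)%N, grid N n <= m%:R & m%:R < grid N n.+1].
  have exn : exists n, m%:R < grid N n.+1.
    have [n Hn] := grid_unbounded N m%:R; exists n.
    by apply: lt_le_trans Hn _; exact: grid_mono.
  case: (ex_minnP exn) => n Hn nmin; exists n.
  have n0n : (n0 <= n)%N.
    rewrite leqNgt; apply/negP => nn0; have := grid_mono N nn0; lra.
  rewrite n0n Hn andbT /=.
  case: n n0n Hn nmin => [|n] n0n Hn nmin.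
    have -> : 0%N = n0 by apply/eqP; rewrite eq_sym -leqn0.
    lra.
  by rewrite leNgt; apply/negP => /nmin; rewrite ltnn.
have gS : grid N n.+1 = grid N n * (1 + N.+1%:R^-1) by rewrite /grid exprSr.
have N1 : N.+1%:R^-1 <= 1 :> R by rewrite invf_le1// ler1n.
have N0 : 0 < N.+1%:R^-1 :> R by rewrite invr_gt0.
have [h hE] : exists h : R, N.+1%:R^-1 = h by eexists.
rewrite hE in NM gS N1 N0.
have Ha : `|D (Num.truncn (grid N n))| <= grid N n * (eps / 8).
  have := Hn0 n n0n; rewrite normrM normfV (gtr0_norm (grid_gt0 N n)).
  by rewrite ler_pdivrMr// mulrC.
have Hb : `|D (Num.truncn (grid N n.+1))| <= grid N n.+1 * (eps / 8).
  have := Hn0 n.+1 (leqW n0n); rewrite normrM normfV (gtr0_norm (grid_gt0 N n.+1)).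
  by rewrite ler_pdivrMr// mulrC.
have /andP[a1 a2] := truncn_itv (ltW (grid_gt0 N n)).
have /andP[b1 b2] := truncn_itv (ltW (grid_gt0 N n.+1)).
set ka := Num.truncn (grid N n) in Ha a1 a2 *.
set kb := Num.truncn (grid N n.+1) in Hb b1 b2 *.
have kam : (ka <= m)%N by rewrite -(ler_nat R); lra.
have mkb : (m <= kb)%N by rewrite truncn_ge_nat// ltW.
have := D_diff kam; have := D_diff mkb.
have h1 : (kb%:R - m%:R) * M <= m%:R * (eps / 4).
  apply: (@le_trans _ _ (m%:R * h * M)); last first.
    by rewrite -mulrA ler_pM2l// mulrC.
  apply: ler_wpM2r => //; apply: (@le_trans _ _ (grid N n.+1 - m%:R)); first lra.
  rewrite gS; have : grid N n * h <= m%:R * h by rewrite ler_pM2r.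
  lra.
have h2 : (m%:R - ka%:R) * M <= m%:R * (eps / 4) + M.
  apply: (@le_trans _ _ ((m%:R * h + 1)* M)); last first.
    by rewrite mulrDl mul1r lerD2r -mulrA ler_pM2l// mulrC.
  apply: ler_wpM2r => //; apply: (@le_trans _ _ (grid N n.+1 - grid N n + 1)).
    by move: gn1 a2; rewrite -natr1; lra.
  rewrite gS; have : grid N n * h <= m%:R * h by rewrite ler_pM2r.
  lra.
have gb2 : grid N n.+1 <= 2 * m%:R by rewrite gS; nra.
have Hb' : `|D kb| <= m%:R * (eps / 4).
  by apply: le_trans Hb _; nra.
have Ha' : `|D ka| <= m%:R * (eps / 8).
  by apply: le_trans Ha _; rewrite ler_pM2r// divr_gt0.
move: Ha' Hb'; rewrite !ler_norml => /andP[? ?] /andP[? ?] D1 D2.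
rewrite ler_pdivlMr// ler_pdivrMr//; apply/andP; split; nra.
Unshelve. all: by end_near.
Qed.

End etemadi_sandwich.

Lemma integrable_bounded d (Omega : measurableType d) (R : realType)
    (P : {finite_measure set Omega -> \bar R}) (f : Omega -> R) (C : R) :
  measurable_fun setT f -> (forall x, `|f x| <= C) ->
  P.-integrable setT (EFin \o f).
Proof.
move=> mf fC; apply: measurable_bounded_integrable => //.
  exact: fin_num_fun_lty.
exists C; split; first exact: num_real.
by move=> M CM x _; apply: le_trans (fC x) (ltW CM).
Qed.

Lemma integrable_scaleR d (Omega : measurableType d) (R : realType)
    (P : {measure set Omega -> \bar R}) (a : R) (f : Omega -> R) :
  P.-integrable setT (EFin \o f) ->
  P.-integrable setT (EFin \o (fun x => a * f x)).
Proof.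
move=> intf; rewrite (_ : EFin \o _ = fun x => (a%:E * (EFin \o f) x)%E)//.
exact: integrableZl.
Qed.

Lemma integrable_addR d (Omega : measurableType d) (R : realType)
    (P : {measure set Omega -> \bar R}) (f g : Omega -> R) :
  P.-integrable setT (EFin \o f) -> P.-integrable setT (EFin \o g) ->
  P.-integrable setT (EFin \o (fun x => f x + g x)).
Proof.
move=> intf intg; rewrite (_ : EFin \o _ = (EFin \o f) \+ (EFin \o g))%E//.
exact: integrableD.
Qed.

Lemma integrable_subR d (Omega : measurableType d) (R : realType)
    (P : {measure set Omega -> \bar R}) (f g : Omega -> R) :
  P.-integrable setT (EFin \o f) -> P.-integrable setT (EFin \o g) ->
  P.-integrable setT (EFin \o (fun x => f x - g x)).
Proof.
move=> intf intg; rewrite (_ : EFin \o _ = (EFin \o f) \- (EFin \o g))%E//.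
exact: integrableB.
Qed.

Lemma integrable_sumR d (Omega : measurableType d) (R : realType)
    (P : {measure set Omega -> \bar R}) n (f : 'I_n -> Omega -> R) :
  (forall i, P.-integrable setT (EFin \o f i)) ->
  P.-integrable setT (EFin \o (fun x => \sum_(i < n) f i x)).
Proof.
move=> intf; rewrite (_ : EFin \o _ = fun x => (\sum_(i < n) (EFin \o f i) x)%E).
  by apply: integrable_sum => // i _; exact: intf.
by apply/funext => x /=; rewrite sumEFin.
Qed.

Lemma Rintegral_sum d (Omega : measurableType d) (R : realType)
    (P : {measure set Omega -> \bar R}) n (f : 'I_n -> Omega -> R) :
  (forall i, P.-integrable setT (EFin \o f i)) ->
  \int[P]_x (\sum_(i < n) f i x) = \sum_(i < n) \int[P]_x f i x.
Proof.
elim: n f => [|n IH] f intf.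
  under eq_Rintegral do rewrite big_ord0.
  by rewrite Rintegral_cst// mul0r big_ord0.
under eq_Rintegral do rewrite big_ord_recr/=.
rewrite RintegralD// ?IH ?big_ord_recr//=.
exact: integrable_sumR.
Qed.

Section slln.
Context d (Omega : measurableType d) (R : realType) (P : probability Omega R).
Variables (V : nat -> Omega -> R) (M : R).
Let grid (N n : nat) : R := (1 + N.+1%:R^-1) ^+ n.
Let tr t j x := Num.min (V j x) t.
Hypothesis mV : forall j, measurable_fun setT (V j).
Hypothesis V0 : forall j x, 0 <= V j x.
Hypothesis intV : forall j, P.-integrable setT (EFin \o V j).
Hypothesis EV : forall j, \int[P]_x V j x <= M.
Hypothesis uncorr : forall i j t, i != j -> 0 < t ->
  \int[P]_x (tr t i x * tr t j x) = \int[P]_x tr t i x * \int[P]_x tr t j x.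
Hypothesis second_moments : forall N, exists (b : nat -> R) (C : R),
  (forall n j, \int[P]_x (tr (grid N n) j x ^+ 2) <= b n) /\
  (forall K, \sum_(n < K) b n / grid N n <= C).
Hypothesis tails : forall e, 0 < e -> exists t0, forall t j, t0 <= t ->
  \int[P]_x V j x - \int[P]_x tr t j x <= e.

Let grid_gt0 N n : 0 < grid N n.
Proof. by rewrite exprn_gt0// ltr_wpDr. Qed.

Let mtr t j : measurable_fun setT (tr t j).
Proof. exact: measurable_minr. Qed.

Let tr_ge0 t j x : 0 < t -> 0 <= tr t j x.
Proof. by move=> t0; rewrite le_min V0 ltW. Qed.

Let tr_le t j x : tr t j x <= t.
Proof. by rewrite ge_min lexx orbT. Qed.

Let int_tr t j : 0 < t -> P.-integrable setT (EFin \o tr t j).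
Proof.
move=> t0; apply: (@integrable_bounded _ _ _ P _ (t)) => // x.
by rewrite ger0_norm// tr_ge0.
Qed.

Let int_trM t i j : 0 < t -> P.-integrable setT (EFin \o (fun x => tr t i x * tr t j x)).
Proof.
move=> t0; apply: (@integrable_bounded _ _ _ P _ (t * t)) => [|x].
  exact: measurable_funM.
by rewrite normrM !ger0_norm ?tr_ge0// ler_pM ?tr_ge0.
Qed.

Let S t k x := \sum_(j < k) tr t j x.
Let ES t k := \sum_(j < k) \int[P]_x tr t j x.

(** Expanding the square gives a double sum of covariances; the off-diagonal ones vanish by
    [uncorr], and a variance is at most the second moment. *)
Let variance_le t k b : 0 < t -> (forall j, \int[P]_x (tr t j x ^+ 2) <= b) ->
  \int[P]_x ((S t k x - ES t k) ^+ 2) <= k%:R * b.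
Proof.
move=> t0 hb; rewrite /S /ES.
have -> : \int[P]_x ((\sum_(j < k) tr t j x - \sum_(j < k) \int[P]_x tr t j x) ^+ 2)
  = \sum_(i < k) \sum_(j < k)
     (\int[P]_x (tr t i x * tr t j x) - \int[P]_x tr t i x * \int[P]_x tr t j x).
  have intc i j : P.-integrable setT (EFin \o (fun x =>
      (tr t i x - \int[P]_x tr t i x) * (tr t j x - \int[P]_x tr t j x))).
    have trM l x : `|tr t l x - \int[P]_x tr t l x| <= t + `|\int[P]_x tr t l x|.
      by apply: le_trans (ler_normB _ _) _; rewrite lerD2r ger0_norm ?tr_ge0.
    apply: (@integrable_bounded _ _ _ P _
      ((t + `|\int[P]_x tr t i x|) * (t + `|\int[P]_x tr t j x|))) => [|x].
      by apply: measurable_funM; apply: measurable_funB.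
    by rewrite normrM ler_pM.
  transitivity (\sum_(i < k) \sum_(j < k) \int[P]_x
      ((tr t i x - \int[P]_x tr t i x) * (tr t j x - \int[P]_x tr t j x))).
    under eq_Rintegral => x _.
      rewrite -sumrB expr2 big_distrlr/=; over.
    rewrite Rintegral_sum; last by move=> i; apply: integrable_sumR => j; exact: intc.
    by apply: eq_bigr => i _; rewrite Rintegral_sum// => j; exact: intc.
  apply: eq_bigr => i _; apply: eq_bigr => j _.
  set a := \int[P]_x tr t i x; set c := \int[P]_x tr t j x.
  under eq_Rintegral => x _.
    rewrite (_ : _ * _ = tr t i x * tr t j x - (a * tr t j x + (c * tr t i x - a * c))); last by ring.
    over.
  have i1 : P.-integrable setT (EFin \o (fun x => a * tr t j x)) by apply: integrable_scaleR; exact: int_tr.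
  have i2 : P.-integrable setT (EFin \o (fun x => c * tr t i x)) by apply: integrable_scaleR; exact: int_tr.
  have i3 : P.-integrable setT (EFin \o (fun x : Omega => a * c)).
    by apply: (@integrable_bounded _ _ _ P _ (`|a * c|)).
  have i4 : P.-integrable setT (EFin \o (fun x => c * tr t i x - a * c)) by exact: integrable_subR.
  have i5 : P.-integrable setT (EFin \o (fun x => a * tr t j x + (c * tr t i x - a * c))) by exact: integrable_addR.
  rewrite RintegralB//; last exact: int_trM.
  rewrite RintegralD// RintegralB//.
  rewrite (RintegralZl _ measurableT (int_tr j t0)) (RintegralZl _ measurableT (int_tr i t0)).
  have -> : \int[P]_x (a * c) = a * c.
    by rewrite /Rintegral integral_cst//= probability_setT mule1.
  by rewrite -/a -/c; ring.
rewrite mulr_natl -[k in leRHS]card_ord -sumr_const.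
apply: ler_sum => i _; rewrite (bigD1 i)//= big1 => [|j ji].
  rewrite addr0; apply: le_trans (hb i); under eq_Rintegral do rewrite -expr2.
  by rewrite lerBlDr lerDl -expr2 sqr_ge0.
by rewrite uncorr ?subrr// eq_sym.
Qed.

Let ES_le t k : 0 < t -> k%:R <= t -> forall e,
  (forall j, \int[P]_x V j x - \int[P]_x tr t j x <= e) ->
  `|(\sum_(j < k) \int[P]_x V j x - ES t k) / t| <= e.
Proof.
move=> t0 kt e he; rewrite -sumrB normrM normfV (gtr0_norm t0) ler_pdivrMr//.
have e0 : 0 <= e.
  apply: le_trans (he 0%N); rewrite subr_ge0; apply: le_Rintegral => //.
  - exact: int_tr.
  - by move=> x _; rewrite ge_min lexx.
rewrite ger0_norm; last first.
  apply: sumr_ge0 => j _; rewrite subr_ge0; apply: le_Rintegral => //.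
  - exact: int_tr.
  - by move=> x _; rewrite ge_min lexx.
apply: (@le_trans _ _ (\sum_(j < k) e)); first by apply: ler_sum => j _; exact: he.
by rewrite sumr_const card_ord -mulr_natl mulrC ler_wpM2l.
Qed.

(* Truncating at the level [grid N n], rather than at [j], makes both the
   Chebyshev bound and the probability that some variable exceeds the level
   bounded by [b n / grid N n]. *)
Let ae_grid N : {ae P, forall x,
  (\sum_(j < Num.truncn (grid N n)) (V j x - \int[P]_y V j y)) / grid N n
    @[n --> \oo] --> 0}.
Proof.
have [b [C [hb hC]]] := second_moments N.
pose k n := Num.truncn (grid N n).
have kt n : (k n)%:R <= grid N n by rewrite truncn_le ltW.
have b0 n : 0 <= b n.
  by apply: le_trans (hb n 0%N); apply: Rintegral_ge0 => x _; rewrite sqr_ge0.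
have trX n j : P.-integrable setT (EFin \o (fun x => tr (grid N n) j x ^+ 2)).
  by under [X in EFin \o X]eq_fun do rewrite expr2; exact: int_trM.
have aeS : {ae P, forall x,
    ((S (grid N n) (k n) x - ES (grid N n) (k n)) / grid N n) ^+ 2
      @[n --> \oo] --> 0}.
  apply: (@ae_cvg0_of_summable _ _ _ _ _ C) => [n|n x|K].
  - apply: measurable_funX; apply: measurable_funM => //.
    by apply: measurable_funB => //; exact: measurable_sum.
  - exact: sqr_ge0.
  - apply: (@le_trans _ _ (\sum_(n < K) (b n / grid N n)%:E)%E); last first.
      by rewrite sumEFin lee_fin.
    apply: lee_sum => n _.
    have iS : P.-integrable setT (EFin \o (fun x =>
        (S (grid N n) (k n) x - ES (grid N n) (k n)) ^+ 2)).
      apply: (@integrable_bounded _ _ _ P _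
          (((k n)%:R * grid N n + `|ES (grid N n) (k n)|) ^+ 2)) => [|x].
        by apply: measurable_funX; apply: measurable_funB => //; exact: measurable_sum.
      rewrite normrX lerXn2r ?nnegrE//; first by rewrite addr_ge0// mulr_ge0// ltW.
      apply: le_trans (ler_normB _ _) _; rewrite lerD2r; apply: le_trans (ler_norm_sum _ _ _) _.
      apply: (@le_trans _ _ (\sum_(j < k n) grid N n)).
        by apply: ler_sum => j _; rewrite ger0_norm ?tr_ge0.
      by rewrite sumr_const card_ord mulr_natl.
    under eq_integral => x _ do rewrite expr_div_n mulrC EFinM.
    rewrite integralZl//= -(fineK (integrable_fin_num _ iS))//= -EFinM lee_fin.
    rewrite mulrC ler_pdivrMr ?exprn_gt0//.
    apply: le_trans (variance_le (k n) (grid_gt0 N n) (hb n)) _.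
    by rewrite expr2 mulrA divfK ?gt_eqF// mulrC ler_wpM2l.
have aeQ : {ae P, forall x,
    \sum_(j < k n) (tr (grid N n) j x / grid N n) ^+ 2 @[n --> \oo] --> 0}.
  apply: (@ae_cvg0_of_summable _ _ _ _ _ C) => [n|n x|K].
  - apply: measurable_sum => j; apply: measurable_funX.
    exact: measurable_funM.
  - by apply: sumr_ge0 => j _; exact: sqr_ge0.
  - apply: (@le_trans _ _ (\sum_(n < K) (b n / grid N n)%:E)%E); last first.
      by rewrite sumEFin lee_fin.
    apply: lee_sum => n _.
    under eq_integral => x _.
      rewrite (_ : \sum_(j < k n) _ = (grid N n) ^- 2 * \sum_(j < k n) tr (grid N n) j x ^+ 2); last first.
        by rewrite mulr_sumr; apply: eq_bigr => j _; rewrite expr_div_n mulrC.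
      rewrite EFinM; over.
    have iS : P.-integrable setT (EFin \o (fun x => \sum_(j < k n) tr (grid N n) j x ^+ 2)).
      by apply: integrable_sumR => j; exact: trX.
    rewrite integralZl//= -(fineK (integrable_fin_num _ iS))//= -EFinM lee_fin.
    rewrite mulrC ler_pdivrMr ?exprn_gt0// expr2 mulrA divfK ?gt_eqF//.
    rewrite -/(Rintegral _ _ _) Rintegral_sum => [|j]; last exact: trX.
    apply: (@le_trans _ _ (\sum_(j < k n) b n)); first by apply: ler_sum => j _; exact: hb.
    by rewrite sumr_const card_ord -mulr_natl mulrC ler_wpM2l.
apply: filterS2 aeS aeQ => x hS hQ.
apply/cvgr0Pnorm_le => e e0.
have [t0 ht0] := tails (divr_gt0 e0 (ltr0n _ 2)).
have [n0 hn0] : exists n0, forall n, (n0 <= n)%N -> t0 <= grid N n.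
  have N0 : 0 < N.+1%:R^-1 :> R by rewrite invr_gt0.
  exists (Num.truncn (`|t0| * N.+1%:R)).+1 => n hn.
  apply: (@le_trans _ _ (grid N (Num.truncn (`|t0| * N.+1%:R)).+1)); last first.
    by rewrite ler_weXn2l// lerDl.
  apply: le_trans (expr1D_ge _ (ltW N0)).
  have := truncnS_gt (`|t0| * N.+1%:R).
  rewrite -(ltr_pM2r N0) mulfK ?pnatr_eq0// => /(le_lt_trans (ler_norm _)) h.
  by rewrite ler_wpDl// ltW.
(* [hS] controls the square of the centred truncated average; the other [e / 2] is left for the
   truncation bias. *)
have e2 : 0 < (e / 2) ^+ 2 by rewrite exprn_gt0// divr_gt0.
have hS' := iffLR (cvgr0Pnorm_le _) hS _ e2.
have hQ' := iffLR (cvgr0Pnorm_lt _) hQ _ ltr01.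
near=> n.
have tn0 : t0 <= grid N n by apply: hn0; near: n; exists n0.
have /(le_lt_trans (ler_norm _)) Qlt1 :
    `|\sum_(j < k n) (tr (grid N n) j x / grid N n) ^+ 2| < 1
  by near: n; exact: hQ'.
(* A variable above the level contributes exactly [1] to the sum in [Qlt1]; since that sum is below
   [1], none of the first [k n] variables is truncated. *)
have Vtr j : (j < k n)%N -> V j x = tr (grid N n) j x.
  move=> jk; rewrite /tr; case: leP => // Vj; exfalso.
  suff : 1 <= \sum_(j < k n) (tr (grid N n) j x / grid N n) ^+ 2.
    by rewrite leNgt Qlt1.
  rewrite (bigD1 (Ordinal jk))//= {1}/tr.
  rewrite (min_idPr (ltW Vj)) divff ?gt_eqF// expr1n lerDl.
  by apply: sumr_ge0 => i _; exact: sqr_ge0.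
rewrite sumrB.
rewrite (eq_bigr (fun j : 'I_(k n) => tr (grid N n) j x)); last by move=> j _; exact: Vtr.
rewrite (_ : _ / _ = (S (grid N n) (k n) x - ES (grid N n) (k n)) / grid N n -
  (\sum_(j < k n) \int[P]_y V j y - ES (grid N n) (k n)) / grid N n); last first.
  by rewrite -mulrBl opprB addrA subrK.
apply: le_trans (ler_normB _ _) _; rewrite [leRHS]splitr; apply: lerD.
  have e20 : 0 <= e / 2 by rewrite divr_ge0// ltW.
  rewrite -(@ler_pXn2r _ 2)// ?nnegrE// -normrX.
  by near: n; exact: hS'.
by apply: ES_le => // j; exact: ht0.
Unshelve. all: by end_near. Qed.

(** What replaces identical distribution is [second_moments] together with [tails], both uniform in
    [j]. The countably many grids share one null set, outside of which [etemadi_sandwich] fills the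
    gaps. *)
Lemma slln : {ae P, forall x,
  (\sum_(j < m) (V j x - \int[P]_y V j y)) / m%:R @[m --> \oo] --> 0}.
Proof.
have := ae_foralln ae_grid; apply: filterS => x hx.
apply: (@etemadi_sandwich _ (V ^~ x) (fun j => \int[P]_y V j y) M) => // j.
by rewrite EV andbT Rintegral_ge0.
Qed.

End slln.

(** * Independence *)

Lemma ge0_integral_law d (Omega : measurableType d) (R : realType)
    (P : {measure set Omega -> \bar R}) d' (S : measurableType d')
    (nu : {measure set S -> \bar R}) (X : Omega -> S) (f : S -> \bar R) :
  measurable_fun setT X ->
  (forall B, measurable B -> P (X @^-1` B) = nu B) ->
  measurable_fun setT f -> (forall s, 0 <= f s)%E ->
  (\int[P]_x f (X x) = \int[nu]_s f s)%E.
Proof.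
move=> mX law mf f0.
rewrite (_ : (\int[P]_x f (X x) = \int[P]_(x in X @^-1` setT) (f \o X) x)%E); last first.
  by rewrite preimage_setT.
rewrite -ge0_integral_pushforward//.
by apply: eq_measure_integral => A mA _; exact: law.
Qed.

Section independence.
Context d (Omega : measurableType d) (R : realType) (P : probability Omega R).

(** Both sides are finite measures in [B]: the law of [X] under [P] restricted to [A], and the law
    of [X] scaled by [P A]. They agree on the pi-system [G], hence everywhere. *)
Lemma independent_event_generated d1 (T : measurableType d1) (X : Omega -> T)
    (G : set (set T)) (A : set Omega) :
  measurable_fun setT X -> measurable A ->
  measurable = <<s G >> -> setI_closed G -> G setT ->
  (forall B, G B -> P (X @^-1` B `&` A) = P (X @^-1` B) * P A)%E ->
  forall B, measurable B -> P (X @^-1` B `&` A) = (P (X @^-1` B) * P A)%E.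
Proof.
move=> mX mA mG GI GT PG B mB.
have mXB C : measurable C -> measurable (X @^-1` C).
  by move=> mC; rewrite -[X in measurable X]setTI; exact: mX.
pose Xm : {mfun Omega >-> T} := HB.pack X (isMeasurableFun.Build _ _ _ _ X mX).
pose m1 : {measure set T -> \bar R} :=
  measure_function_pushforward__canonical__measure_function_Measure (mrestr P mA) mX.
have PA0 : 0 <= fine (P A) by rewrite fine_ge0.
pose m2 : {measure set T -> \bar R} := mscale (NngNum PA0) (distribution P Xm).
have m2E C : m2 C = (P (X @^-1` C) * P A)%E.
  by rewrite /m2/= /mscale/= muleC fineK// fin_num_measure.
rewrite -m2E.
rewrite -[LHS]/(m1 B).
apply: (measure_unique G (fun=> setT)) => //.
- by rewrite bigcup_const.
- by move=> C GC; rewrite m2E -PG.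
- move=> _; have : (P (X @^-1` setT `&` A) < +oo)%E by rewrite preimage_setT setTI ltey_eq fin_num_measure.
  exact.
Qed.

Section two_variables.
Context d1 d2 (T1 : measurableType d1) (T2 : measurableType d2).
Variables (X : Omega -> T1) (Y : Omega -> T2).
Hypotheses (mX : measurable_fun setT X) (mY : measurable_fun setT Y).
Hypothesis indep : forall A B, measurable A -> measurable B ->
  P (X @^-1` A `&` Y @^-1` B) = (P (X @^-1` A) * P (Y @^-1` B))%E.

(** Independence identifies the joint law with the product of the marginal laws, by uniqueness on
    rectangles; Tonelli then splits the integral. *)
Lemma ge0_expectationM (f : T1 -> R) (g : T2 -> R) :
  measurable_fun setT f -> measurable_fun setT g ->
  (forall x, 0 <= f x) -> (forall y, 0 <= g y) ->
  (\int[P]_w (f (X w) * g (Y w))%:E =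
   \int[P]_w (f (X w))%:E * \int[P]_w (g (Y w))%:E)%E.
Proof.
move=> mf mg f0 g0.
pose Xm : {mfun Omega >-> T1} := HB.pack X (isMeasurableFun.Build _ _ _ _ X mX).
pose Ym : {mfun Omega >-> T2} := HB.pack Y (isMeasurableFun.Build _ _ _ _ Y mY).
pose m1 : probability T1 R := distribution P Xm.
pose m2 : probability T2 R := distribution P Ym.
have mXY : measurable_fun setT (fun w => (X w, Y w)) by exact: measurable_fun_pair.
have mfg : measurable_fun setT (fun z : T1 * T2 => (f z.1 * g z.2)%:E).
  apply/measurable_EFinP; apply: measurable_funM.
    by apply: (measurableT_comp mf); exact: measurable_fst.
  by apply: (measurableT_comp mg); exact: measurable_snd.
have fg0 (z : T1 * T2) : (0 <= (f z.1 * g z.2)%:E)%E by rewrite lee_fin mulr_ge0.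
pose Zm : {mfun Omega >-> (T1 * T2)%type} :=
  HB.pack (fun w => (X w, Y w)) (isMeasurableFun.Build _ _ _ _ _ mXY).
have -> : (\int[P]_w (f (X w) * g (Y w))%:E = \int[m1 \x m2]_z (f z.1 * g z.2)%:E)%E.
  rewrite -(@ge0_integral_law _ _ _ P _ _ (m1 \x m2)%E (fun w => (X w, Y w)) (fun z => (f z.1 * g z.2)%:E))//.
  move=> B mB; symmetry.
  apply: (@product_measure_unique _ _ _ _ _ m1 m2 (distribution P Zm)) => // A C mA mC.
rewrite fubini_tonelli1//= /fubini_F/=.
have If : (\int[P]_w (f (X w))%:E = \int[m1]_x (f x)%:E)%E.
  apply: (@ge0_integral_law _ _ _ P _ _ m1 X (fun x => (f x)%:E)) => //.
  exact/measurable_EFinP.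
have Ig : (\int[P]_w (g (Y w))%:E = \int[m2]_x (g x)%:E)%E.
  apply: (@ge0_integral_law _ _ _ P _ _ m2 Y (fun x => (g x)%:E)) => //.
  exact/measurable_EFinP.
rewrite If Ig.
have inner x : (\int[m2]_y (f x * g y)%:E = (f x)%:E * \int[m2]_y (g y)%:E)%E.
  under eq_integral => y _ do rewrite EFinM.
  by rewrite ge0_integralZl_EFin// => [y _|]; [rewrite lee_fin|exact/measurable_EFinP].
under eq_integral => x _ do rewrite inner.
apply: (@ge0_integralZr _ _ _ m1 setT measurableT (fun x => (f x)%:E)) => //.
- exact/measurable_EFinP.
- by move=> x _; rewrite lee_fin.
- by apply: integral_ge0 => y _; rewrite lee_fin.
Qed.

End two_variables.

(** The pi-system argument with measurable rectangles is applied twice, first to one pair against a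
    fixed event, then to the other pair. *)
Lemma independent_pairs d1 d2 (S : measurableType d1) (T : measurableType d2)
    (X X' : Omega -> S) (Y Y' : Omega -> T) :
  measurable_fun setT X -> measurable_fun setT X' ->
  measurable_fun setT Y -> measurable_fun setT Y' ->
  (forall A B A' B', measurable A -> measurable B ->
    measurable A' -> measurable B' ->
    P ((X @^-1` A `&` Y @^-1` B) `&` (X' @^-1` A' `&` Y' @^-1` B')) =
    (P (X @^-1` A `&` Y @^-1` B) * P (X' @^-1` A' `&` Y' @^-1` B'))%E) ->
  forall C C' : set (S * T), measurable C -> measurable C' ->
    P ((fun w => (X w, Y w)) @^-1` C `&` (fun w => (X' w, Y' w)) @^-1` C') =
    (P ((fun w => (X w, Y w)) @^-1` C) * P ((fun w => (X' w, Y' w)) @^-1` C'))%E.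
Proof.
move=> mX mX' mY mY' h.
have mXY : measurable_fun setT (fun w => (X w, Y w)) by exact: measurable_fun_pair.
have mXY' : measurable_fun setT (fun w => (X' w, Y' w)) by exact: measurable_fun_pair.
pose G : set (set (S * T)) := [set C | exists2 A, measurable A & exists2 B, measurable B & A `*` B = C].
have mG : @measurable _ (S * T)%type = <<s G >> by exact: measurable_prod_measurableType.
have GI : setI_closed G.
  move=> _ _ [A mA [B mB <-]] [A' mA' [B' mB' <-]].
  exists (A `&` A'); first exact: measurableI.
  by exists (B `&` B'); [exact: measurableI|rewrite setXI].
have GT : G setT by exists setT => //; exists setT => //; rewrite setXTT.
have pre Z (mZ : measurable_fun setT Z) (C : set (S * T)) : measurable C -> measurable (Z @^-1` C : set Omega).
  by move=> mC; rewrite -[X in measurable X]setTI; exact: mZ.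
move=> C C' mC mC'.
apply: (independent_event_generated _ _ mG) => //; first exact: pre.
move=> _ [A mA [B mB <-]].
rewrite setIC muleC.
apply: (independent_event_generated _ _ mG) => //.
  by apply: pre => //; exact: measurableX.
move=> _ [A' mA' [B' mB' <-]].
by rewrite setIC muleC; exact: h.
Qed.

End independence.

(** * Weighted sums over an identically distributed design *)

Section geometric_sums.
Variables (R : realType) (a : R).
Hypothesis a1 : 1 < a.

(** A geometric sum is at most [a / (a - 1)] times its last term. In the induction, either the last
    term counts, and then it is at most [x], or it is zero. *)
Lemma sum_expr_le_indic K (x : R) : 0 <= x ->
  \sum_(n < K) (if a ^+ n <= x then a ^+ n else 0) <= a / (a - 1) * x.
Proof.
move=> x0; have a0 : 0 < a - 1 by rewrite subr_gt0.
elim: K => [|K IH].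
  by rewrite big_ord0 mulr_ge0// divr_ge0 ?ltW// (lt_trans _ a1).
rewrite big_ord_recr/=; case: ifPn => [aK|_]; last by rewrite addr0.
apply: (@le_trans _ _ (\sum_(n < K.+1) a ^+ n)).
  rewrite big_ord_recr lerD2r/=; apply: ler_sum => n _; case: ifP => // _.
  by rewrite exprn_ge0// ltW// (lt_trans _ a1).
rewrite -(ler_pM2l a0) -subrX1 exprS mulrA mulrCA divff ?gt_eqF// mulr1.
have : a * a ^+ K <= a * x by rewrite ler_pM2l// (lt_trans _ a1).
by move=> ?; lra.
Qed.

Lemma sum_expr_geometric_le (q : R) m K : 0 <= q < 1 ->
  \sum_(i < K) q ^+ (m + i) <= q ^+ m / (1 - q).
Proof.
move=> /andP[q0 q1]; rewrite ler_pdivlMr ?subr_gt0//.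
under eq_bigr do rewrite exprD.
rewrite -mulr_sumr -mulrA ler_piMr ?exprn_ge0// mulrC.
have -> : (1 - q) * \sum_(i < K) q ^+ i = 1 - q ^+ K.
  by rewrite -opprB mulNr -subrX1 opprB.
by rewrite gerBl exprn_ge0.
Qed.

Lemma powR_exprn (x s : R) n : 0 <= x -> (x ^+ n) `^ s = (x `^ s) ^+ n.
Proof.
move=> x0; elim: n => [|n IH]; first by rewrite !expr0 powR1.
by rewrite !exprS powRM ?exprn_ge0// IH.
Qed.

(** The offset [m] is what the induction moves: vanishing leading terms are dropped until
    [x < a ^+ m], after which the whole geometric tail is bounded by its first term, at most [x] to
    the power [- s]. *)
Lemma sum_expr_powR_indic K m (x s : R) : 0 < x -> 0 < s ->
  \sum_(i < K) (if x < a ^+ (m + i) then (a `^ s)^-1 ^+ (m + i) else 0) <=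
  (x `^ s)^-1 / (1 - (a `^ s)^-1).
Proof.
move=> x0 s0; have a0 : 0 < a by rewrite (lt_trans _ a1).
have as1 : 1 < a `^ s.
  have := gt0_ltr_powR s0 _ _ a1; rewrite powR1; apply; rewrite nnegrE ?ltW//.
have q0 : 0 <= (a `^ s)^-1 < 1.
  by rewrite invr_ge0 powR_ge0/= invf_lt1// (lt_trans _ as1).
have [q0' q1] := andP q0.
elim: K m => [|K IH] m.
  by rewrite big_ord0 divr_ge0 ?invr_ge0 ?powR_ge0// subr_ge0 ltW.
have [xa|ax] := ltP x (a ^+ m); last first.
  rewrite big_ord_recl/= addn0 ltNge ax add0r.
  by under eq_bigr do rewrite /bump/= add1n addnS -addSn; exact: IH.
apply: (@le_trans _ _ (\sum_(i < K.+1) (a `^ s)^-1 ^+ (m + i))).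
  by apply: ler_sum => i _; case: ifP => // _; rewrite exprn_ge0.
apply: le_trans (sum_expr_geometric_le _ _ q0) _.
rewrite ler_pM2r ?invr_gt0 ?subr_gt0// exprVn -powR_exprn ?(ltW a0)//.
rewrite lef_pV2 ?posrE ?powR_gt0 ?exprn_gt0//.
by apply: ge0_ler_powR; rewrite ?nnegrE ?ltW// exprn_gt0.
Qed.

(* The terms with [a ^+ n <= x] are bounded by [a ^+ n], the others by a
   geometric series of ratio [a `^ (1 - r)]. *)
Lemma sum_min_powR_le r : 1 < r <= 2 -> exists C : R, forall K x, 0 <= x ->
  \sum_(n < K) Num.min ((a ^+ n) ^+ 2) ((a ^+ n) `^ (2 - r) * x `^ r) / a ^+ n
  <= C * x.
Proof.
move=> /andP[r1 r2]; have a0 : 0 < a by rewrite (lt_trans _ a1).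
have s0 : 0 < r - 1 by rewrite subr_gt0.
have an0 n : 0 < a ^+ n by rewrite exprn_gt0.
have tE t : 0 < t -> t `^ (2 - r) = t * (t `^ (r - 1))^-1.
  move=> t0; rewrite -powRN -{2}(powRr1 (ltW t0)) -powRD; first by congr powR; lra.
  by rewrite (gt_eqF t0) implybT.
exists (a / (a - 1) + (1 - (a `^ (r - 1))^-1)^-1) => K x.
rewrite le_eqVlt => /predU1P[<-|x0].
  rewrite mulr0 big1// => n _; rewrite powR0 ?gt_eqF ?(lt_trans _ r1)// mulr0.
  by rewrite (min_idPr _) ?mul0r// sqr_ge0.
rewrite mulrDl; apply: (@le_trans _ _ (\sum_(n < K)
    ((if a ^+ n <= x then a ^+ n else 0) +
     x `^ r * (if x < a ^+ (0 + n) then (a `^ (r - 1))^-1 ^+ (0 + n) else 0)))).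
  apply: ler_sum => n _; rewrite add0n ltNge ler_pdivrMr//.
  case: ifP => /= _; rewrite ge_min.
    by rewrite mulr0 addr0 expr2 lexx.
  rewrite add0r exprVn -powR_exprn ?(ltW a0)//.
  rewrite tE// orbC le_eqVlt; apply/orP; left; apply/orP; left; apply/eqP; ring.
rewrite big_split/= -mulr_sumr; apply: lerD; first exact: (sum_expr_le_indic _ (ltW x0)).
(* The powers combine to [x^r * x^(1-r) = x]; this linearity is what lets mere integrability of
   [psi] suffice later. *)
apply: (@le_trans _ _ (x `^ r * ((x `^ (r - 1))^-1 / (1 - (a `^ (r - 1))^-1)))).
  by rewrite ler_wpM2l ?powR_ge0// sum_expr_powR_indic.
rewrite -(mulr_powRB1 (ltW x0) (lt_trans ltr01 r1)) mulrA mulfK ?gt_eqF ?powR_gt0//.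
by rewrite mulrC.
Qed.

End geometric_sums.

Lemma Rintegral_dominated_cvg0 dS (S : measurableType dS) (R : realType)
    (nu : {measure set S -> \bar R}) (f : nat -> S -> R) (g : S -> R) :
  (forall n, measurable_fun setT (f n)) ->
  nu.-integrable setT (EFin \o g) -> (forall n s, `|f n s| <= g s) ->
  (forall s, f ^~ s @ \oo --> 0) ->
  \int[nu]_s f n s @[n --> \oo] --> 0.
Proof.
move=> mf ig fg f0.
have f0' s : (f n s)%:E @[n --> \oo] --> 0%E.
  by apply: cvg_EFin; [exact: nearW|exact: f0].
have [_ _ h] := @dominated_convergence _ _ _ nu setT measurableT
  (fun n s => (f n s)%:E) (cst 0%E) (EFin \o g) (fun n => iffRL (measurable_EFinP _ _) (mf n))
  (measurable_cst _) (aeW _ (fun s _ => f0' s)) ig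
  (aeW _ (fun s n _ => fg n s)).
apply: fine_cvg; move: h; rewrite integral0; exact.
Qed.

Section weighted_slln.
Context d (Omega : measurableType d) (R : realType) (P : probability Omega R).
Context dS (S : measurableType dS) (nu : {finite_measure set S -> \bar R}).
Variables (xi : nat -> Omega -> S) (e : nat -> Omega -> R) (r M : R).
Hypothesis mxi : forall j, measurable_fun setT (xi j).
Hypothesis law : forall j B, measurable B -> P (xi j @^-1` B) = nu B.
Hypothesis me : forall j, measurable_fun setT (e j).
Hypothesis e0 : forall j w, 0 <= e j w.
Hypothesis r12 : 1 < r <= 2.
Hypothesis er : forall j, (\int[P]_w (e j w `^ r)%:E <= M%:E)%E.
Hypothesis indep : forall j A B, measurable A -> measurable B ->
  P (xi j @^-1` A `&` e j @^-1` B) = (P (xi j @^-1` A) * P (e j @^-1` B))%E.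
Hypothesis indep_pairs : forall i j A B A' B', i != j ->
  measurable A -> measurable B -> measurable A' -> measurable B' ->
  P ((xi i @^-1` A `&` e i @^-1` B) `&` (xi j @^-1` A' `&` e j @^-1` B')) =
  (P (xi i @^-1` A `&` e i @^-1` B) * P (xi j @^-1` A' `&` e j @^-1` B'))%E.

Let r1 : 1 < r. Proof. by case/andP: r12. Qed.
Let r0 : 0 < r. Proof. exact: lt_trans r1. Qed.

Let M0 : 0 <= M.
Proof.
rewrite -lee_fin; apply: le_trans (er 0%N).
by apply: integral_ge0 => w _; rewrite lee_fin powR_ge0.
Qed.

Let ge0_weight_le x : 0 <= x -> x <= 1 + x `^ r.
Proof.
move=> x0; have [x1|x1] := leP x 1; first by rewrite ler_wpDr ?powR_ge0.
rewrite ler_wpDl// -{1}(powRr1 x0); apply: ler_powR; exact: ltW.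
Qed.

Let mer j : measurable_fun setT (fun w => e j w `^ r).
Proof. exact: (measurableT_comp (measurable_powR r)). Qed.

Let E1er j : (\int[P]_w (1 + e j w `^ r)%:E <= (1 + M)%:E)%E.
Proof.
under eq_integral => w _ do rewrite EFinD.
rewrite ge0_integralD//=.
- rewrite integral_cst//= probability_setT mule1 EFinD.
  by apply: leeD2l; exact: er.
- by move=> w _; rewrite lee_fin powR_ge0.
- exact/measurable_EFinP.
Qed.

Let Ee j : (\int[P]_w (e j w)%:E <= (1 + M)%:E)%E.
Proof.
apply: le_trans (E1er j); apply: ge0_le_integral => //.
- by move=> w _; rewrite lee_fin.
- exact/measurable_EFinP.
- by apply/measurable_EFinP; apply: measurable_funD.
- by move=> w _; rewrite lee_fin ge0_weight_le.
Qed.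

Let EM (f : S -> R) (g : R -> R) j :
  measurable_fun setT f -> measurable_fun setT g ->
  (forall s, 0 <= f s) -> (forall y, 0 <= g y) ->
  (\int[P]_w (f (xi j w) * g (e j w))%:E =
   \int[nu]_s (f s)%:E * \int[P]_w (g (e j w))%:E)%E.
Proof.
move=> mf mg f0 g0; rewrite (ge0_expectationM (mxi j) (me j))//; last first.
  by move=> A B mA mB; exact: indep.
congr (_ * _)%E; apply: (ge0_integral_law (mxi j) (law j)) => //.
exact/measurable_EFinP.
Qed.

Section nonnegative.
Variable psi : S -> R.
Hypotheses (mpsi : measurable_fun setT psi) (psi0 : forall s, 0 <= psi s).
Hypothesis ipsi : nu.-integrable setT (EFin \o psi).

Let V j w := psi (xi j w) * e j w.

Let mV j : measurable_fun setT (V j).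
Proof. by apply: measurable_funM => //; exact: (measurableT_comp mpsi). Qed.

Let V0 j w : 0 <= V j w. Proof. exact: mulr_ge0. Qed.

Let psiE : (\int[nu]_s (psi s)%:E = (\int[nu]_s psi s)%:E)%E.
Proof. by rewrite fineK// integrable_fin_num. Qed.

Let EeE j : (\int[P]_w (e j w)%:E = (\int[P]_w e j w)%:E)%E.
Proof.
rewrite fineK// ge0_fin_numE; first exact: (le_lt_trans (Ee j) (ltry _)).
by apply: integral_ge0 => w _; rewrite lee_fin.
Qed.

Let EVE j : (\int[P]_w (V j w)%:E = (\int[nu]_s psi s * \int[P]_w e j w)%:E)%E.
Proof.
(* [EM] asks for a function of the weight that is nonnegative on the whole line, so the identity is
   replaced by the positive part, which agrees with it on the values of [e j]. *)
rewrite /V (eq_integral (fun w => (psi (xi j w) * Num.max (e j w) 0)%:E)); last first.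
  by move=> w _; rewrite (max_idPl (e0 j w)).
rewrite (EM (g := fun y => Num.max y 0))//.
- under [X in (_ * X)%E]eq_integral => w _ do rewrite (max_idPl (e0 j w)).
  by rewrite psiE EeE EFinM.
- exact: measurable_maxr.
- by move=> y; rewrite le_max lexx orbT.
Qed.

Let intV j : P.-integrable setT (EFin \o V j).
Proof.
apply/integrableP; split; first exact/measurable_EFinP.
under eq_integral => w _ do rewrite /= ger0_norm//.
by rewrite EVE ltry.
Qed.

Let EVR j : \int[P]_w V j w = \int[nu]_s psi s * \int[P]_w e j w.
Proof. by rewrite /Rintegral EVE. Qed.

Let Ee_le j : 0 <= \int[P]_w e j w <= 1 + M.
Proof.
by rewrite Rintegral_ge0//= -lee_fin -EeE.
Qed.

Let psi_ge0 : 0 <= \int[nu]_s psi s. Proof. by rewrite Rintegral_ge0. Qed.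

Let V_le j : \int[P]_w V j w <= \int[nu]_s psi s * (1 + M).
Proof. by rewrite EVR ler_wpM2l//; case/andP: (Ee_le j). Qed.

(** The truncated product is one function [f] of the pair [(xi l, e l)], and distinct pairs are
    independent. The positive part inside [f] again ensures nonnegativity off the range of [e l]. *)
Let uncorr i j t : i != j -> 0 < t ->
  \int[P]_w (Num.min (V i w) t * Num.min (V j w) t) =
  \int[P]_w Num.min (V i w) t * \int[P]_w Num.min (V j w) t.
Proof.
move=> ij t0.
pose f (z : S * R) := Num.min (psi z.1 * Num.max z.2 0) t.
have mf : measurable_fun setT f.
  apply: measurable_minr => //; apply: measurable_funM.
    by apply: (measurableT_comp mpsi); exact: measurable_fst.
  by apply: measurable_maxr => //; exact: measurable_snd.
have f0 z : 0 <= f z by rewrite le_min mulr_ge0 ?le_max ?lexx ?orbT//= ltW.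
have fE l w : Num.min (V l w) t = f (xi l w, e l w).
  by rewrite /f/= (max_idPl (e0 l w)).
have mp l : measurable_fun setT (fun w => (xi l w, e l w)) by exact: measurable_fun_pair.
have ft z : f z <= t by rewrite ge_min lexx orbT.
have fin l : (\int[P]_w (f (xi l w, e l w))%:E)%E \is a fin_num.
  apply: integrable_fin_num => //; apply: (@integrable_bounded _ _ _ P _ t) => [|w].
    exact: (measurableT_comp mf (mp l)).
  by rewrite ger0_norm.
under eq_Rintegral do rewrite !fE.
under [X in _ = X * _]eq_Rintegral do rewrite !fE.
under [X in _ = _ * X]eq_Rintegral do rewrite !fE.
rewrite /Rintegral -fineM//; congr fine.
apply: (ge0_expectationM (mp i) (mp j)) => // A B mA mB.
by apply: independent_pairs => // *; exact: indep_pairs.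
Qed.

(** This is the design factor in the bound on the squared truncated product, shaped for
    [sum_min_powR_le]: divided by [t] and summed over [t = a ^+ n], it is at most a constant times
    [psi s]. *)
Let kernel t s := Num.min (t ^+ 2) (t `^ (2 - r) * psi s `^ r).

(* A bound of product form, so that independence separates the two factors
   although the truncated product does not split. *)
Let min_sqr_le (x y t : R) : 0 <= x -> 0 <= y -> 0 < t ->
  (Num.min (x * y) t) ^+ 2 <=
  Num.min (t ^+ 2) (t `^ (2 - r) * x `^ r) * (1 + y `^ r).
Proof.
move=> x0 y0 t0.
have xy0 : 0 <= x * y by rewrite mulr_ge0.
have min0 : 0 <= Num.min (x * y) t by rewrite le_min xy0 ltW.
have h1 : Num.min (x * y) t ^+ 2 <= t ^+ 2.
  by rewrite ler_pXn2r// ?nnegrE ?(ltW t0)// ge_min lexx orbT.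
(* The square is split with exponents [2 - r] and [r]; the first power is bounded through [t], the
   second through [x * y]. *)
have h2 : Num.min (x * y) t ^+ 2 <= t `^ (2 - r) * x `^ r * y `^ r.
  have [z0|z0] := eqVneq (Num.min (x * y) t) 0.
    by rewrite z0 expr0n !mulr_ge0 ?powR_ge0.
  have {1}-> : Num.min (x * y) t ^+ 2 = Num.min (x * y) t `^ ((2 - r) + r).
    by rewrite subrK powR_mulrn.
  rewrite powRD; last by rewrite z0 implybT.
  rewrite -mulrA -powRM//; apply: ler_pM; rewrite ?powR_ge0//.
    apply: ge0_ler_powR; rewrite ?nnegrE ?(ltW t0)//; first by rewrite subr_ge0; case/andP: r12.
    by rewrite ge_min lexx orbT.
  by apply: ge0_ler_powR; rewrite ?nnegrE ?(ltW r0)// ge_min lexx.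
have yr := powR_ge0 y r; set Y := y `^ r in h2 yr *.
rewrite {2}/Num.min; case: ifP => [_|_].
  apply: le_trans h1 _; by rewrite ler_peMr ?sqr_ge0// lerDl.
apply: le_trans h2 _; rewrite ler_wpM2l ?mulr_ge0 ?powR_ge0//.
by rewrite lerDr.
Qed.

Let mkernel t : measurable_fun setT (kernel t).
Proof.
apply: measurable_minr => //; apply: measurable_funM => //.
exact: (measurableT_comp (measurable_powR r)).
Qed.

Let kernel0 t s : 0 <= kernel t s.
Proof. by rewrite le_min sqr_ge0/= mulr_ge0 ?powR_ge0. Qed.

Let ikernel t : nu.-integrable setT (EFin \o kernel t).
Proof.
apply: (@integrable_bounded _ _ _ nu _ (t ^+ 2)) => // s.
by rewrite ger0_norm// ge_min lexx.
Qed.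

(** Independence turns the product bound into the integral of [kernel] times [1 + M], for every [j].
    The sum over the levels is then taken under the integral, where it is at most a multiple of
    [psi]. *)
Let second_moments N : exists (b : nat -> R) (C : R),
  (forall n j, \int[P]_w (Num.min (V j w) ((1 + N.+1%:R^-1) ^+ n) ^+ 2) <= b n) /\
  (forall K, \sum_(n < K) b n / (1 + N.+1%:R^-1) ^+ n <= C).
Proof.
set a := 1 + N.+1%:R^-1 : R; have a1 : 1 < a by rewrite ltrDl invr_gt0.
have an0 n : 0 < a ^+ n by rewrite exprn_gt0// (lt_trans _ a1).
have [C hC] := sum_min_powR_le a1 r12.
exists (fun n => \int[nu]_s kernel (a ^+ n) s * (1 + M)), (C * \int[nu]_s psi s * (1 + M)).
split=> [n j|K].
  have iV2 : P.-integrable setT (EFin \o (fun w => Num.min (V j w) (a ^+ n) ^+ 2)).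
    have m0 w : 0 <= Num.min (V j w) (a ^+ n) by rewrite le_min V0 ltW.
    apply: (@integrable_bounded _ _ _ P _ ((a ^+ n) ^+ 2)) => [|w].
      by apply: measurable_funX; exact: measurable_minr.
    rewrite ger0_norm ?sqr_ge0// ler_pXn2r ?nnegrE ?(ltW (an0 n))//.
    by rewrite ge_min lexx orbT.
  rewrite -lee_fin fineK ?integrable_fin_num//.
  apply: (@le_trans _ _ (\int[P]_w (kernel (a ^+ n) (xi j w) * (1 + e j w `^ r))%:E)%E).
    apply: ge0_le_integral => //.
    - by move=> w _; rewrite lee_fin sqr_ge0.
    - exact: (measurable_int _ iV2).
    - apply/measurable_EFinP; apply: measurable_funM.
        exact: (measurableT_comp (mkernel _)).
      exact: measurable_funD.
    - by move=> w _; rewrite lee_fin min_sqr_le.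
  rewrite (EM (g := fun y => 1 + y `^ r))//.
  - rewrite -(fineK (integrable_fin_num _ (ikernel (a ^+ n))))// EFinM.
    by apply: lee_wpmul2l => //; rewrite lee_fin Rintegral_ge0.
  - exact: measurable_funD.
  - by move=> y; rewrite addr_ge0// powR_ge0.
under eq_bigr do rewrite -mulrA (mulrC (1 + M)) mulrA.
rewrite -mulr_suml ler_wpM2r ?addr_ge0//.
have ik n : nu.-integrable setT (EFin \o (fun s => (a ^+ n)^-1 * kernel (a ^+ n) s)).
  by apply: integrable_scaleR; exact: ikernel.
rewrite (eq_bigr (fun n : 'I_K => \int[nu]_s ((a ^+ n)^-1 * kernel (a ^+ n) s))); last first.
  by move=> n _; rewrite RintegralZl// mulrC.
rewrite -Rintegral_sum// -RintegralZl//; apply: le_Rintegral => //.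
- exact: integrable_sumR.
- exact: integrable_scaleR.
- move=> s _; apply: le_trans (hC K (psi s) (psi0 s)).
  by apply: ler_sum => n _; rewrite mulrC.
Qed.

(** Cutting [x] at [K] leaves the excess of [K * y] over [t], and where [K * y > t] one has
    [K * y <= (K * y)^r / t^(r-1)]. In expectation the first term is small by the choice of [K], the
    second by the choice of [t], both uniformly in [j]. *)
Let excess_le (x y K t : R) : 0 <= x -> 0 <= y -> 0 < K -> 0 < t ->
  x * y - Num.min (x * y) t <=
  (x - Num.min x K) * y + K `^ r * (t `^ (r - 1))^-1 * y `^ r.
Proof.
move=> x0 y0 K0 t0.
have A0 : 0 <= (x - Num.min x K) * y by rewrite mulr_ge0// subr_ge0 ge_min lexx.
have B0 : 0 <= K `^ r * (t `^ (r - 1))^-1 * y `^ r.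
  by rewrite !mulr_ge0 ?invr_ge0 ?powR_ge0.
have [xyt|xyt] := leP (x * y) t; first by rewrite subrr addr_ge0.
have xm : x * y - t <= (x - Num.min x K) * y + (K * y - t).
  have : x <= (x - Num.min x K) + K by have : Num.min x K <= K; [rewrite ge_min lexx orbT|lra].
  by move=> h; have := ler_wpM2r y0 h; lra.
apply: le_trans xm _; rewrite lerD2l.
have [Kyt|Kyt] := leP (K * y) t; first by rewrite (le_trans _ B0)// subr_le0.
apply: (@le_trans _ _ (K * y)); first by rewrite lerBlDr lerDl ltW.
have Ky0 : 0 <= K * y by rewrite mulr_ge0// ltW.
rewrite mulrAC -powRM// ?(ltW K0)//; set z := K * y in Ky0 Kyt *.
rewrite -(mulr_powRB1 Ky0 r0) -mulrA ler_peMr//.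
rewrite ler_pdivlMr ?powR_gt0// mul1r.
by apply: ge0_ler_powR; rewrite ?nnegrE ?(ltW t0)// ?(ltW Kyt)// subr_ge0 ltW.
Qed.

Let psi_tail eps : 0 < eps -> exists2 K : R, 0 < K &
  \int[nu]_s psi s - \int[nu]_s Num.min (psi s) K <= eps.
Proof.
move=> eps0.
have mmin K : measurable_fun setT (fun s => Num.min (psi s) K) by exact: measurable_minr.
have h : \int[nu]_s (psi s - Num.min (psi s) n.+1%:R) @[n --> \oo] --> 0.
  apply: (Rintegral_dominated_cvg0 _ ipsi) => [n|n s|s].
  - exact: measurable_funB.
  - rewrite ger0_norm ?subr_ge0 ?ge_min ?lexx// lerBlDr lerDl le_min psi0/=.
    exact: ler0n.
  - apply/cvgr0Pnorm_le => e1 e10; near=> n.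
    rewrite (min_idPl _) ?subrr ?normr0 ?(ltW e10)//.
    apply: ltW; apply: lt_le_trans (truncnS_gt _) _; rewrite ler_nat ltnS.
    by near: n; exists (Num.truncn (psi s)).
have [n _ hn] := iffLR (cvgr0Pnorm_le _) h _ eps0.
exists n.+1%:R => //; rewrite -RintegralB//.
  exact: le_trans (ler_norm _) (hn n (leqnn n)).
apply: (le_integrable measurableT _ _ ipsi) => //.
  exact/measurable_EFinP.
move=> s _; rewrite /= lee_fin !ger0_norm ?ge_min ?lexx//.
by rewrite le_min psi0 ler0n.
Unshelve. all: by end_near. Qed.

Let tails eps : 0 < eps -> exists t0, forall t j, t0 <= t ->
  \int[P]_w V j w - \int[P]_w Num.min (V j w) t <= eps.
Proof.
move=> eps0; have M1 : 0 < 1 + M by rewrite ltr_pwDl.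
have eps1 : 0 < eps / 2 / (1 + M) by rewrite !divr_gt0.
have [K K0 hK] := psi_tail eps1.
have s0 : 0 < r - 1 by rewrite subr_gt0.
(* The second term of [excess_le] has expectation at most [eps / 2] as soon as [t^(r-1) >= c].
   Neither [K] nor [c] depends on [j]. *)
pose c := 2 * K `^ r * M / eps.
have c0 : 0 <= c by rewrite divr_ge0 ?mulr_ge0 ?powR_ge0// ltW.
exists (1 + c `^ (r - 1)^-1) => t j tt0.
have t1 : 1 <= t by apply: le_trans tt0; rewrite lerDl powR_ge0.
have t0 : 0 < t by exact: lt_le_trans t1.
have ct : c <= t `^ (r - 1).
  have cE : c = (c `^ (r - 1)^-1) `^ (r - 1).
    by rewrite -powRrM mulVf ?gt_eqF// powRr1.
  rewrite [leLHS]cE.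
  apply: ge0_ler_powR; rewrite ?nnegrE ?powR_ge0 ?(ltW s0) ?(ltW t0)//.
  by apply: le_trans tt0; rewrite lerDr.
have cM : K `^ r * (t `^ (r - 1))^-1 * M <= eps / 2.
  rewrite mulrAC ler_pdivrMr ?powR_gt0//.
  move: ct; rewrite /c ler_pdivrMr// => ct; lra.
have mmin : measurable_fun setT (fun w => Num.min (V j w) t) by exact: measurable_minr.
have imin : P.-integrable setT (EFin \o (fun w => Num.min (V j w) t)).
  apply: (@integrable_bounded _ _ _ P _ t) => // w.
  by rewrite ger0_norm ?ge_min ?lexx ?orbT// le_min V0 ltW.
rewrite -RintegralB// -lee_fin fineK; last first.
  by apply: integrable_fin_num => //; exact: integrable_subR.
pose h s := psi s - Num.min (psi s) K.
have h0 s : 0 <= h s by rewrite subr_ge0 ge_min lexx.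
have mh : measurable_fun setT h by apply: measurable_funB => //; exact: measurable_minr.
apply: (@le_trans _ _ (\int[P]_w ((h (xi j w) * Num.max (e j w) 0)%:E +
    (K `^ r * (t `^ (r - 1))^-1 * e j w `^ r)%:E))%E).
  apply: ge0_le_integral => //.
  - by move=> w _; rewrite lee_fin subr_ge0 ge_min lexx.
  - by apply/measurable_EFinP; exact: measurable_funB.
  - apply/measurable_EFinP; apply: measurable_funD.
      apply: measurable_funM; first exact: (measurableT_comp mh).
      exact: measurable_maxr.
    exact: measurable_funM.
  - by move=> w _; rewrite -EFinD lee_fin (max_idPl (e0 j w)) excess_le.
have Kt0 : 0 <= K `^ r * (t `^ (r - 1))^-1 by rewrite mulr_ge0 ?invr_ge0 ?powR_ge0.
rewrite ge0_integralD//=; first last.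
- by apply/measurable_EFinP; exact: measurable_funM.
- by move=> w _; rewrite lee_fin mulr_ge0// powR_ge0.
- apply/measurable_EFinP; apply: measurable_funM; first exact: (measurableT_comp mh).
  exact: measurable_maxr.
- by move=> w _; rewrite lee_fin mulr_ge0// le_max lexx orbT.
rewrite [eps]splitr EFinD; apply: leeD.
  rewrite (EM (g := fun y => Num.max y 0))//; first last.
  - by move=> y; rewrite le_max lexx orbT.
  - exact: measurable_maxr.
  under [X in (_ * X)%E]eq_integral => w _ do rewrite (max_idPl (e0 j w)).
  have imK : nu.-integrable setT (EFin \o (fun s => Num.min (psi s) K)).
    apply: (@integrable_bounded _ _ _ nu _ K) => [|s]; first exact: measurable_minr.
    by rewrite ger0_norm ?ge_min ?lexx ?orbT// le_min psi0 ltW.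
  rewrite EeE -(fineK (integrable_fin_num measurableT (integrable_subR ipsi imK)))//.
  rewrite -EFinM lee_fin -/(Rintegral _ _ _) RintegralB//.
  rewrite (@le_trans _ _ (eps / 2 / (1 + M) * (1 + M)))//; last first.
    by rewrite divfK// gt_eqF.
  have /andP[? ?] := Ee_le j.
  apply: ler_pM => //; rewrite subr_ge0; apply: le_Rintegral => // s _.
  by rewrite ge_min lexx.
under eq_integral => w _ do rewrite EFinM.
rewrite ge0_integralZl_EFin//; last first.
- exact/measurable_EFinP.
- by move=> w _; rewrite lee_fin powR_ge0.
apply: (@le_trans _ _ ((K `^ r * (t `^ (r - 1))^-1)%:E * M%:E)%E).
  by apply: lee_wpmul2l => //; rewrite lee_fin.
by rewrite -EFinM lee_fin.
Qed.

Lemma ge0_weighted_slln : {ae P, forall w,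
  (\sum_(j < m) (psi (xi j w) * e j w - \int[nu]_s psi s * \int[P]_w' e j w')) / m%:R
    @[m --> \oo] --> 0}.
Proof.
have := slln mV V0 intV V_le uncorr second_moments tails.
by apply: filterS => w; under eq_cvg do under eq_bigr do rewrite EVR.
Qed.

End nonnegative.

Lemma expectation_weight j : 0 <= \int[P]_w e j w <= 1 + M.
Proof.
rewrite Rintegral_ge0//= -lee_fin fineK//.
rewrite ge0_fin_numE; first exact: (le_lt_trans (Ee j) (ltry _)).
by apply: integral_ge0 => w _; rewrite lee_fin.
Qed.

(** The monotonicity in the sandwich requires nonnegative terms, so the positive and negative parts
    of [psi] are treated separately and subtracted. *)
Lemma weighted_slln psi : measurable_fun setT psi ->
  nu.-integrable setT (EFin \o psi) -> {ae P, forall w,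
  (\sum_(j < m) (psi (xi j w) * e j w - \int[nu]_s psi s * \int[P]_w' e j w')) / m%:R
    @[m --> \oo] --> 0}.
Proof.
move=> mpsi ipsi.
have inpsi : nu.-integrable setT (EFin \o (fun s => - psi s)).
  by under [X in EFin \o X]eq_fun do rewrite -mulN1r; exact: integrable_scaleR.
have ipos g : measurable_fun setT g -> nu.-integrable setT (EFin \o g) ->
    nu.-integrable setT (EFin \o (fun s => Num.max (g s) 0)).
  move=> mg ig; apply: (le_integrable measurableT _ _ ig).
    by apply/measurable_EFinP; exact: measurable_maxr.
  by move=> s _; rewrite /= lee_fin [leLHS]ger0_norm ?le_max ?lexx ?orbT// ge_max ler_norm normr_ge0.
have mneg : measurable_fun setT (fun s => - psi s) by exact: measurableT_comp.
have mp : measurable_fun setT (fun s => Num.max (psi s) 0) by exact: measurable_maxr.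
have mn : measurable_fun setT (fun s => Num.max (- psi s) 0) by exact: measurable_maxr.
have max0 (x : R) : 0 <= Num.max x 0 by rewrite le_max lexx orbT.
have maxB (x : R) : Num.max x 0 - Num.max (- x) 0 = x.
  by rewrite /Num.max oppr_lt0; case: (ltgtP x 0) => [||->]; rewrite ?sub0r ?opprK ?subr0.
have := ge0_weighted_slln mp (fun=> max0 _) (ipos _ mpsi ipsi).
have := ge0_weighted_slln mn (fun=> max0 _) (ipos _ mneg inpsi).
apply: filterS2 => w h1 h2.
pose A (g : S -> R) m := (\sum_(j < m)
  (g (xi j w) * e j w - \int[nu]_s g s * \int[P]_w' e j w')) / m%:R.
have h : A (fun s => Num.max (psi s) 0) m - A (fun s => Num.max (- psi s) 0) m
    @[m --> \oo] --> (0 - 0 : R) by exact: cvgB h2 h1.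
rewrite subr0 in h; apply: cvg_trans h; apply: near_eq_cvg; apply: nearW => m; rewrite /A.
rewrite -mulrBl -sumrB; congr (_ / _); apply: eq_bigr => j _.
rewrite -[X in _ = X * _ - _]maxB.
have -> : \int[nu]_s psi s = \int[nu]_s Num.max (psi s) 0 - \int[nu]_s Num.max (- psi s) 0.
  rewrite -RintegralB ?ipos//; by apply: eq_Rintegral => s _; rewrite maxB.
by ring.
Qed.

End weighted_slln.

(** * Uniform strong laws on compact parameter sets *)

(** Explicit radii are convenient here: they are compared, halved and combined over finite covers,
    and the point [s] of the sample space enters as a parameter. *)
Definition eps_delta_continuous_on (R : realType) n (K : set 'rV[R]_n)
    (g : 'rV[R]_n -> R) := forall a, K a -> forall e, 0 < e ->
  exists2 dl, 0 < dl & forall b, K b -> `|b - a| < dl -> `|g b - g a| < e.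

Lemma eps_delta_continuousP (R : realType) n (K : set 'rV[R]_n) (g : 'rV[R]_n -> R) :
  {within K, continuous g} <-> eps_delta_continuous_on K g.
Proof.
split=> [/subspace_continuousP cg a Ka e e0|cg].
  have /cvgrPdist_lt/(_ e e0) := cg a Ka.
  rewrite near_withinE => /nbhs_ballP[dl /= dl0 h]; exists dl => // b Kb ba.
  rewrite distrC; apply: h => //; by rewrite mx_norm_ball /ball_/= distrC.
apply/subspace_continuousP => a Ka; apply/cvgrPdist_lt => e e0.
have [dl dl0 h] := cg a Ka e e0.
rewrite near_withinE; apply/nbhs_ballP; exists dl => //= b.
by rewrite mx_norm_ball /ball_/= distrC => ba Kb; rewrite distrC; exact: h.
Qed.

Lemma compact_finite_cover (R : realType) n (K : set 'rV[R]_n) (dl : 'rV[R]_n -> R) :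
  compact K -> (forall a, K a -> 0 < dl a) ->
  exists2 s : seq 'rV[R]_n, (forall a, a \in s -> K a) &
    forall a, K a -> exists2 b, b \in s & `|a - b| < dl b.
Proof.
move=> Kc dl0; have : cover_compact K by rewrite -compact_cover.
move=> /(_ _ K (fun a => ball a (dl a)))[].
- by move=> a Ka; apply: ball_open; exact: dl0.
- by move=> a Ka; exists a => //; apply: ballxx; exact: dl0.
move=> C CK Ccov; exists (finmap.enum_fset C) => [a aC|a Ka].
  exact/set_mem/CK.
have [b /= bC ba] := Ccov a Ka; exists b => //.
by move: ba; rewrite mx_norm_ball /ball_/= distrC.
Qed.

(** Heine-Cantor: cover [K] by finitely many balls of half the local radius; a lower bound of these
    halves serves as the uniform modulus. *)
Lemma compact_uniformly_continuous (R : realType) n (K : set 'rV[R]_n) (g : 'rV[R]_n -> R) :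
  compact K -> eps_delta_continuous_on K g -> forall e, 0 < e ->
  exists2 dl, 0 < dl & forall a b, K a -> K b -> `|a - b| < dl -> `|g a - g b| < e.
Proof.
move=> Kc cg e e0.
have /choice[dl hdl] a : exists dl, K a -> 0 < dl /\
    forall b, K b -> `|b - a| < dl -> `|g b - g a| < e / 2.
  have [Ka|] := pselect (K a); last by exists 0.
  by have [dl dl0 h] := cg a Ka _ (divr_gt0 e0 (ltr0n _ 2)); exists dl.
have [|s sK scov] := @compact_finite_cover _ _ K (fun a => dl a / 2) Kc.
  by move=> a /hdl[? _]; rewrite divr_gt0.
have [m m0 hm] : exists2 m, 0 < m & forall a, a \in s -> m <= dl a / 2.
  elim: s sK {scov} => [|x s IH] sK; first by exists 1.
  have [a asi|m m0 hm] := IH; first by apply: sK; rewrite inE asi orbT.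
  have [dx0 _] := hdl x (sK x (mem_head x s)).
  exists (Num.min m (dl x / 2)); first by rewrite lt_min m0 divr_gt0.
  move=> a; rewrite inE => /predU1P[->|/hm ma]; first by rewrite ge_min lexx orbT.
  by rewrite ge_min ma.
exists m => // a b Ka Kb ab; have [x xs ax] := scov a Ka.
have [dx0 h] := hdl x (sK x xs); have mx := hm x xs.
have bx : `|b - x| < dl x.
  have -> : b - x = (a - x) - (a - b) by rewrite opprB [RHS]addrC addrA subrK.
  by apply: le_lt_trans (ler_normB _ _) _; rewrite [ltRHS]splitr ltrD// (lt_le_trans ab).
have -> : g a - g b = (g a - g x) - (g b - g x) by ring.
apply: le_lt_trans (ler_normB _ _) _; rewrite [ltRHS]splitr ltrD ?h//.
by rewrite (lt_trans ax)// ltr_pdivrMr// mulr2n mulrDr mulr1 ltrDl.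
Qed.

(** [K] may contain no rational point, so the enumeration runs over pairs of a precision and a
    rational vector, and picks a point of [K] that close to the vector whenever one exists ([k0]
    otherwise). *)
Lemma dense_sequence (R : realType) n (K : set 'rV[R]_n) : K !=set0 ->
  exists2 q : nat -> 'rV[R]_n, (forall i, K (q i)) &
    forall a, K a -> forall dl, 0 < dl -> exists i, `|q i - a| < dl.
Proof.
move=> [k0 Kk0].
pose near_rat (mr : nat * 'rV[rat]_n) (b : 'rV[R]_n) :=
  K b /\ `|b - map_mx ratr mr.2| < mr.1.+1%:R^-1.
pose q i := if unpickle i is Some mr then
  (if pselect (exists b, near_rat mr b) is left h then projT1 (cid h) else k0) else k0.
exists q => [i|a Ka dl dl0].
  rewrite /q; case: unpickle => // mr; case: pselect => // h.
  by case: cid => b [].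
pose m := Num.truncn (2 / dl).
have m0 : 0 < m.+1%:R^-1 :> R by rewrite invr_gt0.
have mdl : m.+1%:R^-1 < dl / 2.
  rewrite -[ltRHS]invrK ltf_pV2 ?posrE ?invr_gt0 ?divr_gt0// invf_div.
  exact: truncnS_gt.
have hr (i : 'I_n) : exists x : rat, `|a ord0 i - ratr x| < m.+1%:R^-1.
  move: (a ord0 i) m0 => y; move: (m.+1%:R^-1 : R) => h h0.
  have : y - h < y + h by lra.
  case/rat_in_itvoo => x; rewrite in_itv/= => /andP[x1 x2].
  by exists x; rewrite ltr_norml; apply/andP; split; lra.
pose x : 'rV[rat]_n := \row_i projT1 (cid (hr i)).
have xa : `|a - map_mx ratr x| < m.+1%:R^-1.
  have : ball a m.+1%:R^-1 (map_mx ratr x).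
    by split => // i j; rewrite !mxE ord1/= /ball_; case: cid.
  by rewrite mx_norm_ball.
exists (pickle (m, x)); rewrite /q pickleK; case: pselect => [h|]; last first.
  by case; exists a.
case: cid => b [/= Kb hb].
rewrite (_ : b - a = (b - map_mx ratr x) - (a - map_mx ratr x)); last by rewrite opprB addrA subrK.
by apply: le_lt_trans (ler_normB _ _) _; rewrite [dl]splitr ltrD// (lt_trans _ mdl).
Qed.

Section bracketing.
Context dS (S : measurableType dS) (R : realType).
Variables (nu : {measure set S -> \bar R}) (n : nat) (K : set 'rV[R]_n).
Variables (f : 'rV[R]_n -> S -> R) (D : S -> R).
Hypothesis mf : forall a, K a -> measurable_fun setT (f a).
Hypothesis cf : forall s, eps_delta_continuous_on K (f ^~ s).
Hypothesis fD : forall a s, K a -> `|f a s| <= D s.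
Hypothesis iD : nu.-integrable setT (EFin \o D).

Lemma dominated_integrable_on a : K a -> nu.-integrable setT (EFin \o f a).
Proof.
move=> Ka; apply: (le_integrable measurableT _ _ iD).
  by apply/measurable_EFinP; exact: mf.
by move=> s _; rewrite lee_fin (le_trans (fD s Ka))// ler_norm.
Qed.

(** [psi] is the oscillation of [f] around [a], taken over a dense sequence so that it is
    measurable. It is at most [2 * D] and vanishes pointwise as the radius shrinks, so dominated
    convergence yields one radius for all [s], although the modulus of continuity depends on [s]. *)
Lemma bracket a e : K a -> 0 < e -> exists (dl : R) (psi : S -> R),
  [/\ 0 < dl, measurable_fun setT psi, nu.-integrable setT (EFin \o psi) &
      [/\ forall s, 0 <= psi s, \int[nu]_s psi s <= e &
      forall b, K b -> `|b - a| < dl -> forall s, `|f b s - f a s| <= psi s]].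
Proof.
move=> Ka e0.
have [q Kq dq] := dense_sequence (ex_intro K a Ka).
pose u m k s := if `|q k - a| < m.+1%:R^-1 then `|f (q k) s - f a s| else 0.
pose osc m s := sups (fun k => u m k s) 0.
have u0 m k s : 0 <= u m k s by rewrite /u; case: ifP.
have uD m k s : u m k s <= 2 * D s.
  have D0 : 0 <= D s by apply: le_trans (fD s Ka).
  rewrite /u; case: ifP => _; last by rewrite mulr_ge0.
  by apply: le_trans (ler_normB _ _) _; rewrite mulr2n mulrDl mul1r lerD ?fD.
have ub m s : has_ubound (range (fun k => u m k s)).
  by exists (2 * D s) => _ [k _ <-].
have uosc m k s : u m k s <= osc m s.
  by apply: ub_le_sup; [case: (ub m s) => M hM; exists M => _ [i _ <-]; apply: hM; exists i|exists k].
have osc_le m s M : (forall k, u m k s <= M) -> osc m s <= M.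
  move=> h; apply: ge_sup; first by exists (u m 0 s); exists 0%N.
  by move=> _ [i _ <-].
have osc0 m s : 0 <= osc m s by apply: le_trans (uosc m 0 s).
have mosc m : measurable_fun setT (osc m).
  apply: measurable_fun_sups => [s _|k]; first exact: ub.
  rewrite /u; case: (`|q k - a| < m.+1%:R^-1) => //; apply: measurableT_comp => //.
  by apply: measurable_funB; apply: mf.
have i2D : nu.-integrable setT (EFin \o (fun s => 2 * D s)) by exact: integrable_scaleR.
have iosc m : nu.-integrable setT (EFin \o osc m).
  apply: (le_integrable measurableT _ _ i2D); first exact/measurable_EFinP.
  move=> s _; rewrite lee_fin ger0_norm// (le_trans _ (ler_norm _))//.
  exact: osc_le.
have h : \int[nu]_s osc m s @[m --> \oo] --> 0.
  apply: (Rintegral_dominated_cvg0 mosc i2D) => [m s|s].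
    by rewrite ger0_norm//; exact: osc_le.
  apply/cvgr0Pnorm_le => e1 e10; have [dl dl0 hdl] := cf s Ka e10.
  exists (Num.truncn dl^-1) => // m /= hm.
  rewrite ger0_norm//; apply: osc_le => k; rewrite /u; case: ifPn => [h|_]; last exact: ltW.
  apply/ltW/hdl => //; apply: lt_trans h _.
  rewrite -[ltRHS]invrK ltf_pV2 ?posrE ?invr_gt0//.
  by apply: lt_le_trans (truncnS_gt _) _; rewrite ler_nat.
have [m _ hm] := iffLR (cvgr0Pnorm_le _) h _ e0.
exists m.+1%:R^-1, (osc m); split => //; split => //.
  by apply: le_trans (ler_norm _) (hm m (leqnn m)).
(* A general [b] is reached from a point [q k] so close to it that [q k] still lies in the ball
   around [a] and [f (q k) s] is within [e1] of [f b s]. *)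
move=> b Kb ba s; apply/ler_addgt0Pr => e1 e10.
have [dl dl0 hdl] := cf s Kb e10.
have [k hk] : exists k, `|q k - b| < Num.min dl (m.+1%:R^-1 - `|b - a|).
  by apply: dq => //; rewrite lt_min dl0 subr_gt0.
move: hk; rewrite lt_min => /andP[k1 k2].
have qka : `|q k - a| < m.+1%:R^-1.
  have -> : q k - a = (q k - b) + (b - a) by rewrite addrA subrK.
  by apply: le_lt_trans (ler_normD _ _) _; rewrite -ltrBrDr.
have -> : f b s - f a s = (f (q k) s - f a s) - (f (q k) s - f b s).
  by ring.
apply: le_trans (ler_normB _ _) _; apply: lerD; last exact/ltW/hdl.
by have := uosc m k s; rewrite /u qka.
Qed.

Lemma dominated_Rintegral_continuous :
  eps_delta_continuous_on K (fun a => \int[nu]_s f a s).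
Proof.
move=> a Ka e e0; have [dl [psi [dl0 mpsi ipsi [psi0 psie h]]]] := bracket Ka (divr_gt0 e0 (ltr0n _ 2)).
exists dl => // b Kb ba; apply: (@le_lt_trans _ _ (e / 2)); last lra.
rewrite -RintegralB//; [|exact: dominated_integrable_on..].
have ifb : nu.-integrable setT (EFin \o (fun s => f b s - f a s)).
  by apply: integrable_subR; exact: dominated_integrable_on.
apply: le_trans (le_normr_Rintegral measurableT ifb) _; apply: le_trans psie.
apply: le_Rintegral => //; last by move=> s _; exact: h.
exact: integrable_norm ifb.
Qed.

End bracketing.

Section uniform_slln.
Context d (Omega : measurableType d) (R : realType) (P : {measure set Omega -> \bar R}).
Context dS (S : measurableType dS) (nu : {measure set S -> \bar R}).
Variables (xi : nat -> Omega -> S) (e : nat -> Omega -> R) (kap : nat -> R) (M : R).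
Hypothesis e0 : forall j w, 0 <= e j w.
Hypothesis kapM : forall j, 0 <= kap j <= M.
Hypothesis lln : forall psi, measurable_fun setT psi ->
  nu.-integrable setT (EFin \o psi) -> {ae P, forall w,
  (\sum_(j < m) (psi (xi j w) * e j w - \int[nu]_s psi s * kap j)) / m%:R
    @[m --> \oo] --> 0}.
Variables (n : nat) (K : set 'rV[R]_n) (f : 'rV[R]_n -> S -> R) (D : S -> R).
Hypothesis Kc : compact K.
Hypothesis mf : forall a, K a -> measurable_fun setT (f a).
Hypothesis cf : forall s, eps_delta_continuous_on K (f ^~ s).
Hypothesis fD : forall a s, K a -> `|f a s| <= D s.
Hypothesis iD : nu.-integrable setT (EFin \o D).

Let A psi w m := (\sum_(j < m) (psi (xi j w) * e j w - \int[nu]_s psi s * kap j)) / m%:R.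

(** Compactness selects finitely many bracket centres; the law is invoked only for [f] and for the
    bracket at these centres, and the brackets transfer it to all of [K]. *)
Lemma uniform_slln_eps eps : 0 < eps -> {ae P, forall w,
  \forall m \near \oo, forall a, K a -> `|A (f a) w m| <= eps}.
Proof.
move=> eps0.
have M0 : 0 <= M by have /andP[] := kapM 0; exact: le_trans.
(* The budget is [eta] at the centre, [eta] for the deviation of the bracket average, and
   [2 * M * eta] for the expectations of the bracket. *)
pose eta := eps / (2 + 2 * M).
have eta0 : 0 < eta by rewrite divr_gt0//; lra.
have /choice[dl /choice[psi hb]] a : exists (dl : R) (psi : S -> R), K a ->
  [/\ 0 < dl, measurable_fun setT psi, nu.-integrable setT (EFin \o psi) &
      [/\ forall s, 0 <= psi s, \int[nu]_s psi s <= eta &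
      forall b, K b -> `|b - a| < dl -> forall s, `|f b s - f a s| <= psi s]].
  have [Ka|nKa] := pselect (K a); last by exists 0, (cst 0).
  by have [dl [psi h]] := bracket mf cf fD iD Ka eta0; exists dl, psi.
have [[k0 Kk0]|/set0P/negP/negPn/eqP K0] := pselect (K !=set0); last first.
  by apply: aeW => w; apply: nearW => m a; rewrite K0.
have [|s sK scov] := @compact_finite_cover _ _ K dl Kc.
  by move=> a Ka; case: (hb a Ka).
(* The default [k0] lies in [K], so [c i] is in [K] for every natural [i] and the almost sure
   statement can be quantified over all of [nat]. *)
pose c i := nth k0 s i.
have Kc' i : K (c i).
  rewrite /c; have [iC|iC] := ltnP i (size s); first by apply: sK; exact: mem_nth.
  by rewrite nth_default.
have aeall : {ae P, forall w, forall i,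
   A (f (c i)) w m @[m --> \oo] --> 0 /\ A (psi (c i)) w m @[m --> \oo] --> 0}.
  apply: ae_foralln => i; have [_ mpsi ipsi _] := hb _ (Kc' i).
  have := lln (mf (Kc' i)) (dominated_integrable_on mf fD iD (Kc' i)).
  have := lln mpsi ipsi.
  by apply: filterS2 => w h1 h2; split.
apply: filterS aeall => w hw.
have near_all : \forall m \near \oo, forall i : 'I_(size s),
    `|A (f (c i)) w m| <= eta /\ `|A (psi (c i)) w m| <= eta.
  apply: filter_forall => i; have [h1 h2] := hw i.
  move/cvgr0Pnorm_le/(_ _ eta0) : h1; move/cvgr0Pnorm_le/(_ _ eta0) : h2.
  by apply: filterS2 => m ? ?; split.
near=> m => a Ka.
have m0 : 0 < m%:R :> R by rewrite ltr0n; near: m; exists 1%N.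
have [a' a's a'a] := scov a Ka.
have iC : (index a' s < size s)%N by rewrite index_mem.
pose i := Ordinal iC.
have ci : c i = a' by rewrite /c/= nth_index.
have [h1 h2] : `|A (f (c i)) w m| <= eta /\ `|A (psi (c i)) w m| <= eta.
  by move: (i); near: m; exact: near_all.
rewrite ci in h1 h2; have Ka' : K a' by rewrite -ci.
have [dl0 mpsi ipsi [psi0 psie hpsi]] := hb _ Ka'.
have {}hpsi x : `|f a x - f a' x| <= psi a' x.
  exact: hpsi.
pose I := \int[nu]_s psi a' s.
have I0 : 0 <= I by rewrite Rintegral_ge0.
(* One [I * M] bounds the difference of the centring terms; the other arises from centring the
   bracket average itself. *)
have diff : `|A (f a) w m - A (f a') w m| <= A (psi a') w m + 2 * (I * M).
  rewrite /A -mulrBl -sumrB normrM normfV (gtr0_norm m0) ler_pdivrMr// mulrDl divfK ?gt_eqF//.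
  apply: le_trans (ler_norm_sum _ _ _) _.
  have -> : 2 * (I * M) * m%:R = \sum_(j < m) 2 * (I * M).
    by rewrite sumr_const card_ord mulr_natr.
  rewrite -big_split/=; apply: ler_sum => j _.
  have -> : f a (xi j w) * e j w - \int[nu]_s f a s * kap j -
      (f a' (xi j w) * e j w - \int[nu]_s f a' s * kap j) =
      (f a (xi j w) - f a' (xi j w)) * e j w -
      (\int[nu]_s f a s - \int[nu]_s f a' s) * kap j by ring.
  have ifa b : K b -> nu.-integrable setT (EFin \o f b) by exact: (dominated_integrable_on mf fD iD).
  have Idiff : `|\int[nu]_s f a s - \int[nu]_s f a' s| <= I.
    rewrite -RintegralB//; [|exact: ifa..].
    have ifb := integrable_subR (ifa _ Ka) (ifa _ Ka').
    apply: le_trans (le_normr_Rintegral measurableT ifb) _.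
    by apply: le_Rintegral => //; exact: integrable_norm ifb.
  apply: le_trans (ler_normB _ _) _; rewrite !normrM (ger0_norm (e0 j w)).
  have /andP[k0' kM] := kapM j; rewrite (ger0_norm k0').
  have : `|f a (xi j w) - f a' (xi j w)| * e j w <= psi a' (xi j w) * e j w by rewrite ler_wpM2r.
  have : `|\int[nu]_s f a s - \int[nu]_s f a' s| * kap j <= I * kap j by rewrite ler_wpM2r.
  have : I * kap j <= I * M by rewrite ler_wpM2l.
  rewrite -/I; lra.
have IM : I * M <= eta * M by rewrite ler_wpM2r.
have -> : A (f a) w m = (A (f a) w m - A (f a') w m) + A (f a') w m by rewrite subrK.
apply: le_trans (ler_normD _ _) _.
have -> : eps = eta * (2 + 2 * M) by rewrite divfK// gt_eqF//; lra.
have := le_trans (ler_norm _) h2; lra.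
Unshelve. all: by end_near. Qed.

Lemma uniform_slln : {ae P, forall w, forall eps : R, 0 < eps ->
  \forall m \near \oo, forall a, K a -> `|A (f a) w m| <= eps}.
Proof.
have : {ae P, forall w, forall i : nat,
  \forall m \near \oo, forall a, K a -> `|A (f a) w m| <= i.+1%:R^-1}.
  by apply: ae_foralln => i; apply: uniform_slln_eps; rewrite invr_gt0.
apply: filterS => w h eps eps0; have := h (Num.truncn eps^-1).
apply: filterS => m hm a Ka; apply: le_trans (hm a Ka) _.
by rewrite -[leRHS]invrK lef_pV2 ?posrE ?invr_gt0// ltW// truncnS_gt.
Qed.

End uniform_slln.

Section uniform_laws.
Context d (Omega : measurableType d) (R : realType) (P : probability Omega R).
Context dS (S : measurableType dS) (nu : {finite_measure set S -> \bar R}).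
Variable xi : nat -> Omega -> S.
Hypothesis mxi : forall j, measurable_fun setT (xi j).
Hypothesis law : forall j B, measurable B -> P (xi j @^-1` B) = nu B.
Variables (n : nat) (K : set 'rV[R]_n) (f : 'rV[R]_n -> S -> R) (D : S -> R).
Hypothesis Kc : compact K.
Hypothesis mf : forall a, K a -> measurable_fun setT (f a).
Hypothesis cf : forall s, eps_delta_continuous_on K (f ^~ s).
Hypothesis fD : forall a s, K a -> `|f a s| <= D s.
Hypothesis iD : nu.-integrable setT (EFin \o D).

(** The weights are the constant [1], with [r = 2] and [M = 1]. Preimages under a constant are empty
    or full, so the joint independence conditions reduce to those on [xi]. *)
Lemma uniform_slln_identically_distributed :
  (forall i j A A', i != j -> measurable A -> measurable A' ->
    P (xi i @^-1` A `&` xi j @^-1` A') = (P (xi i @^-1` A) * P (xi j @^-1` A'))%E) ->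
  {ae P, forall w, forall eps : R, 0 < eps -> \forall m \near \oo, forall a, K a ->
    `|(\sum_(j < m) (f a (xi j w) - \int[nu]_s f a s)) / m%:R| <= eps}.
Proof.
move=> indep.
pose e (j : nat) (w : Omega) : R := 1.
have me j : measurable_fun setT (e j) by exact: measurable_cst.
have e0 j w : 0 <= e j w by [].
have r12 : 1 < (2 : R) <= 2 by rewrite lexx andbT ltr1n.
have er j : (\int[P]_w (e j w `^ 2)%:E <= 1%:E)%E.
  under eq_integral do rewrite powR1.
  by rewrite integral_cst//= probability_setT mule1.
have pre j B : e j @^-1` B = setT \/ e j @^-1` B = set0.
  have [B1|B1] := pselect (B 1); [left|right]; first by rewrite -subTset => w _.
  by rewrite -subset0 => w.
have ind j A B : measurable A -> measurable B ->
    P (xi j @^-1` A `&` e j @^-1` B) = (P (xi j @^-1` A) * P (e j @^-1` B))%E.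
  move=> _ _; have [->|->] := pre j B; first by rewrite setIT probability_setT mule1.
  by rewrite setI0 measure0 mule0.
have ind2 i j A B A' B' : i != j -> measurable A -> measurable B -> measurable A' -> measurable B' ->
    P ((xi i @^-1` A `&` e i @^-1` B) `&` (xi j @^-1` A' `&` e j @^-1` B')) =
    (P (xi i @^-1` A `&` e i @^-1` B) * P (xi j @^-1` A' `&` e j @^-1` B'))%E.
  move=> ij mA _ mA' _.
  have [->|->] := pre i B; last by rewrite setI0 set0I measure0 mul0e.
  have [->|->] := pre j B'; last by rewrite !setI0 measure0 mule0.
  by rewrite !setIT indep.
have lln := weighted_slln mxi law me e0 r12 er ind ind2.
have kap := expectation_weight me e0 r12 er.
have := uniform_slln e0 kap lln Kc mf cf fD iD.
apply: filterS => w h eps /h; apply: filterS => m hm a /hm.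
congr (`|_ / _| <= _); apply: eq_bigr => j _.
have -> : \int[P]_w' e j w' = 1.
  by rewrite /Rintegral /e integral_cst//= probability_setT mule1.
by rewrite !mulr1.
Qed.

(** The positive and negative parts of [E j] inherit its moments and independence. As [E j] is
    centred, both have the same expectation, and the centring terms cancel in the difference of the
    two laws. *)
Lemma uniform_slln_centered_weights (E : nat -> Omega -> R) (r M : R) :
  (forall j, measurable_fun setT (E j)) -> 1 < r <= 2 ->
  (forall j, (\int[P]_w (`|E j w| `^ r)%:E <= M%:E)%E) ->
  (forall j, P.-integrable setT (EFin \o E j)) ->
  (forall j, \int[P]_w E j w = 0) ->
  (forall j A B, measurable A -> measurable B ->
    P (xi j @^-1` A `&` E j @^-1` B) = (P (xi j @^-1` A) * P (E j @^-1` B))%E) ->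
  (forall i j A B A' B', i != j ->
    measurable A -> measurable B -> measurable A' -> measurable B' ->
    P ((xi i @^-1` A `&` E i @^-1` B) `&` (xi j @^-1` A' `&` E j @^-1` B')) =
    (P (xi i @^-1` A `&` E i @^-1` B) * P (xi j @^-1` A' `&` E j @^-1` B'))%E) ->
  {ae P, forall w, forall eps : R, 0 < eps -> \forall m \near \oo, forall a, K a ->
    `|(\sum_(j < m) f a (xi j w) * E j w) / m%:R| <= eps}.
Proof.
move=> mE r12 EM iE E0 ind1 ind2.
have [r1 _] := andP r12.
have half (g : R -> R) : measurable_fun setT g -> (forall x, 0 <= g x) ->
    (forall x, g x <= `|x|) ->
  {ae P, forall w, forall eps : R, 0 < eps -> \forall m \near \oo, forall a, K a ->
    `|(\sum_(j < m) (f a (xi j w) * g (E j w) -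
        \int[nu]_s f a s * \int[P]_w' g (E j w'))) / m%:R| <= eps}.
  move=> mg g0 gabs; pose e j w := g (E j w).
  have me j : measurable_fun setT (e j) by exact: (measurableT_comp mg (mE j)).
  have e0 j w : 0 <= e j w by exact: g0.
  have er j : (\int[P]_w (e j w `^ r)%:E <= M%:E)%E.
    apply: le_trans (EM j); apply: ge0_le_integral => //.
    - by move=> w _; rewrite lee_fin powR_ge0.
    - by apply/measurable_EFinP; exact: (measurableT_comp (measurable_powR r)).
    - apply/measurable_EFinP; apply: (measurableT_comp (measurable_powR r)).
      exact: measurableT_comp.
    - move=> w _; rewrite lee_fin; apply: ge0_ler_powR; rewrite ?nnegrE//.
        by rewrite ltW// (lt_trans _ r1).
      exact: gabs.
  have pre j B : e j @^-1` B = E j @^-1` (g @^-1` B) by [].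
  have mpre B : measurable B -> measurable (g @^-1` B).
    by move=> mB; rewrite -[X in measurable X]setTI; exact: mg.
  have ind j A B : measurable A -> measurable B ->
      P (xi j @^-1` A `&` e j @^-1` B) = (P (xi j @^-1` A) * P (e j @^-1` B))%E.
    by move=> mA /mpre mB; rewrite pre ind1.
  have ind' i j A B A' B' : i != j -> measurable A -> measurable B -> measurable A' -> measurable B' ->
      P ((xi i @^-1` A `&` e i @^-1` B) `&` (xi j @^-1` A' `&` e j @^-1` B')) =
      (P (xi i @^-1` A `&` e i @^-1` B) * P (xi j @^-1` A' `&` e j @^-1` B'))%E.
    by move=> ij mA /mpre mB mA' /mpre mB'; rewrite !pre ind2.
  have lln := weighted_slln mxi law me e0 r12 er ind ind'.
  have kap := expectation_weight me e0 r12 er.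
  exact: (uniform_slln e0 kap lln Kc mf cf fD iD).
have mp : measurable_fun setT (fun x : R => Num.max x 0) by exact: measurable_maxr.
have mn : measurable_fun setT (fun x : R => Num.max (- x) 0).
  by apply: measurable_maxr => //; exact: measurableT_comp.
have max0 (x : R) : 0 <= Num.max x 0 by rewrite le_max lexx orbT.
have maxabs (x : R) : Num.max x 0 <= `|x| by rewrite ge_max ler_norm normr_ge0.
have maxB (x : R) : Num.max x 0 - Num.max (- x) 0 = x.
  by rewrite /Num.max oppr_lt0; case: (ltgtP x 0) => [||->]; rewrite ?sub0r ?opprK ?subr0.
have iposE (g : R -> R) j : measurable_fun setT g -> (forall x, 0 <= g x) -> (forall x, g x <= `|x|) ->
    P.-integrable setT (EFin \o (fun w => g (E j w))).
  move=> mg g0 gabs; apply: (le_integrable measurableT _ _ (iE j)).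
    by apply/measurable_EFinP; exact: (measurableT_comp mg).
  by move=> w _; rewrite lee_fin ger0_norm.
have nabs (x : R) : Num.max (- x) 0 <= `|x| by rewrite -normrN.
have := half _ mp max0 maxabs.
have := half _ mn (fun=> max0 _) nabs.
apply: filterS2 => w hn hp eps eps0; have e2 : 0 < eps / 2 by rewrite divr_gt0.
have := hn _ e2; have := hp _ e2; apply: filterS2 => m h1 h2 a Ka.
have -> : (\sum_(j < m) f a (xi j w) * E j w) / m%:R =
  (\sum_(j < m) (f a (xi j w) * Num.max (E j w) 0 -
        \int[nu]_s f a s * \int[P]_w' Num.max (E j w') 0)) / m%:R -
  (\sum_(j < m) (f a (xi j w) * Num.max (- E j w) 0 -
        \int[nu]_s f a s * \int[P]_w' Num.max (- E j w') 0)) / m%:R.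
  rewrite -mulrBl -sumrB; congr (_ / _); apply: eq_bigr => j _.
  have h0 : \int[P]_w' Num.max (E j w') 0 - \int[P]_w' Num.max (- E j w') 0 = 0.
    have ip := iposE _ j mp max0 maxabs.
    have iN := iposE _ j mn (fun=> max0 _) nabs.
    rewrite -RintegralB//.
    by rewrite -[RHS](E0 j); apply: eq_Rintegral => w' _; rewrite maxB.
  rewrite -{1}(maxB (E j w)); set I := \int[nu]_s f a s.
  set p := \int[P]_w' _ in h0 *; set q := \int[P]_w' _ in h0 *.
  have -> : p = q by apply/eqP; rewrite -subr_eq0 h0.
  by ring.
apply: le_trans (ler_normB _ _) _; rewrite [eps]splitr.
by apply: lerD; [exact: h1|exact: h2].
Qed.

End uniform_laws.

(** * Empirical features of continuous functions *)

Lemma open_Borel (T : ptopologicalType) (A : set T) : open A ->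
  measurable (A : set (Borel T)).
Proof. exact: sub_sigma_algebra. Qed.

Lemma closed_Borel (T : ptopologicalType) (A : set T) : closed A ->
  measurable (A : set (Borel T)).
Proof. by move=> /closed_openC/open_Borel/measurableC; rewrite setCK. Qed.

Lemma within_continuous_Borel (R : realType) (T : ptopologicalType) (A : set T)
    (f : T -> R) : measurable (A : set (Borel T)) -> {within A, continuous f} ->
  measurable_fun (A : set (Borel T)) (f : Borel T -> R).
Proof.
move=> mA /continuousP cf; apply: (measurability _ (RGenOpens.measurableE R)).
move=> _ [_ [a [b ->] <-]].
have /open_subspaceP[V oV VA] := cf _ (@interval_open _ (BRight a) (BLeft b) isT isT).
rewrite setIC -VA; apply: measurableI => //; exact: open_Borel.
Qed.

Lemma continuous_Borel (R : realType) (T : ptopologicalType) (f : T -> R) :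
  continuous f -> measurable_fun setT (f : Borel T -> R).
Proof.
move=> cf; apply: within_continuous_Borel; first exact: measurableT.
exact: continuous_subspaceT.
Qed.

Lemma compact_rV_closed (R : realType) n (K : set 'rV[R]_n) : compact K -> closed K.
Proof. by apply: compact_closed; exact: norm_hausdorff. Qed.

(** The cells are small balls made disjoint one after the other. A centre need not lie in its own
    cell; only its distance to the points of the cell matters. With [h] free, one partition produces
    step functions for every continuous function. *)
Lemma small_partition (R : realType) n (K : set 'rV[R]_n) (dl : R) :
  compact K -> 0 < dl -> exists (s : nat) (c : nat -> 'rV[R]_n)
    (C : nat -> set (Borel 'rV[R]_n)),
  [/\ forall i, measurable (C i), forall i, (i < s)%N -> K (c i) &
    forall x, K x -> exists i : 'I_s, `|x - c i| < dl /\
      forall h : nat -> R, \sum_(j < s) h j * \1_(C j) x = h i].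
Proof.
move=> Kc dl0; have [s sK scov] := compact_finite_cover Kc (fun _ _ => dl0).
pose c i := nth 0 s i.
(* [seqDU] works on an infinite sequence, hence the empty sets beyond the finite cover. *)
pose B i : set (Borel 'rV[R]_n) := if (i < size s)%N then ball (c i) dl else set0.
exists (size s), c, (seqDU B); split => [|i iS|x Kx].
- apply: seqDU_measurable => i; rewrite /B; case: ifP => // _.
  by apply: open_Borel; exact: ball_open.
- by apply: sK; exact: mem_nth.
have [b bs xb] := scov x Kx.
have : (\bigcup_i B i) x.
  exists (index b s) => //; rewrite /B index_mem bs /c nth_index//.
  by rewrite mx_norm_ball /ball_/= distrC.
rewrite seqDU_bigcup_eq => -[i _ iBx].
have : B i x by case: iBx.
rewrite /B; case: ifP => // iS xi; exists (Ordinal iS); split.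
  by move: xi; rewrite mx_norm_ball /ball_/= distrC.
move=> h; rewrite (bigD1 (Ordinal iS))//= indicE mem_set// mulr1 big1 ?addr0// => j ji.
rewrite indicE memNset ?mulr0// => jBx.
have := @trivIset_seqDU _ B j i I I (ex_intro _ x (conj jBx iBx)).
by move=> jiE; move/eqP: ji; apply; exact/val_inj.
Qed.

Section random_design.
Context d (Omega : measurableType d) (R : realType) (P : probability Omega R).
Variables (u n : nat) (Z : set 'rV[R]_u) (K : set 'rV[R]_n).
Hypotheses (Zc : compact Z) (Kc : compact K).
Variable mu : {finite_measure set (Borel 'rV[R]_u) -> \bar R}.
Variables (F : 'rV[R]_n -> 'rV[R]_u -> R) (D : Borel 'rV[R]_u -> R).
Hypothesis cF : forall x, Z x -> {within K, continuous (F ^~ x)}.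
Hypothesis mF : forall a, K a ->
  measurable_fun (Z : set (Borel 'rV[R]_u)) (F a : Borel 'rV[R]_u -> R).
Hypothesis iD : mu.-integrable Z (EFin \o D).
Hypothesis FD : forall a x, K a -> Z x -> `|F a x| <= D x.

Let mZ : measurable (Z : set (Borel 'rV[R]_u)).
Proof. by apply: closed_Borel; exact: compact_rV_closed. Qed.

(** Extension by [0] off [Z] fits the laws above, which are stated on the whole space. In [DZ] the
    absolute value makes the envelope nonnegative even when [K] is empty. *)
Let FZ a : Borel 'rV[R]_u -> R := (F a : Borel 'rV[R]_u -> R) \_ Z.
Let DZ : Borel 'rV[R]_u -> R := (fun x => `|D x|) \_ Z.

Let mFZ a : K a -> measurable_fun setT (FZ a).
Proof. by move=> Ka; apply/(measurable_restrictT _ mZ); exact: mF. Qed.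

Let iDZ : mu.-integrable setT (EFin \o DZ).
Proof.
rewrite /DZ -restrict_EFin; apply/(integrable_mkcond _ mZ).
by have := integrable_abse iD.
Qed.

Let DZ0 x : 0 <= DZ x. Proof. by rewrite /DZ patchE; case: ifP. Qed.

Let FDZ a x : K a -> `|FZ a x| <= DZ x.
Proof.
move=> Ka; rewrite /FZ /DZ !patchE; case: ifPn; last by rewrite normr0.
by rewrite inE => Zx; rewrite (le_trans (FD Ka Zx))// ler_norm.
Qed.

Let cFZ x : eps_delta_continuous_on K (FZ ^~ x).
Proof.
have [Zx|nZx] := pselect (Z x).
  apply/eps_delta_continuousP; rewrite (_ : FZ ^~ x = F ^~ x); first exact: cF.
  by apply/funext => a; rewrite /FZ patchE mem_set.
move=> a Ka e e0; exists 1 => // b Kb _; rewrite /FZ !patchE memNset//.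
by rewrite subrr normr0.
Qed.

Let gZ (g : 'rV[R]_u -> R) : Borel 'rV[R]_u -> R := (g : Borel 'rV[R]_u -> R) \_ Z.

Let mgZ g : {within Z, continuous g} -> measurable_fun setT (gZ g).
Proof.
by move=> cg; apply/(measurable_restrictT _ mZ); exact: within_continuous_Borel.
Qed.

Let gZE g x : Z x -> gZ g x = g x.
Proof. by move=> Zx; rewrite /gZ patchE mem_set. Qed.

Let Rintegral_FZ a (g : 'rV[R]_u -> R) :
  \int[mu]_(x in Z) (F a x * g x) = \int[mu]_x (FZ a x * gZ g x).
Proof.
rewrite Rintegral_mkcond; apply: eq_Rintegral => x _.
by rewrite /FZ /gZ !patchE; case: ifP => // _; rewrite mul0r.
Qed.

Let FZM_le a (g : Borel 'rV[R]_u -> R) C : K a ->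
  (forall x, Z x -> `|g x| <= C) -> forall x, `|FZ a x * g x| <= C * DZ x.
Proof.
move=> Ka gC x; rewrite normrM mulrC; have [Zx|nZx] := pselect (Z x).
  by apply: ler_pM => //; [exact: gC|exact: FDZ].
by rewrite /FZ /DZ !patchE memNset// normr0 !mulr0.
Qed.

Let integrable_FZM a (g : Borel 'rV[R]_u -> R) C : K a -> measurable_fun setT g ->
  (forall x, Z x -> `|g x| <= C) -> mu.-integrable setT (EFin \o (fun x => FZ a x * g x)).
Proof.
move=> Ka mg gC; apply: (le_integrable measurableT _ _ (integrable_scaleR C iDZ)).
  by apply/measurable_EFinP; apply: measurable_funM => //; exact: mFZ.
by move=> x _; rewrite lee_fin (le_trans _ (ler_norm _))// FZM_le.
Qed.

Let Rintegral_FZM_le a (g : Borel 'rV[R]_u -> R) C : K a -> measurable_fun setT g ->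
  (forall x, Z x -> `|g x| <= C) -> `|\int[mu]_x (FZ a x * g x)| <= C * \int[mu]_x DZ x.
Proof.
move=> Ka mg gC; have iFg := integrable_FZM Ka mg gC.
apply: le_trans (le_normr_Rintegral measurableT iFg) _.
rewrite -RintegralZl//; apply: le_Rintegral => //.
- exact: integrable_norm iFg.
- exact: integrable_scaleR.
- by move=> x _; exact: FZM_le.
Qed.

Let within_continuous_bounded (g : 'rV[R]_u -> R) : {within Z, continuous g} ->
  exists C, forall x, Z x -> `|g x| <= C.
Proof.
move=> cg; have /compact_bounded[M [_ hM]] := continuous_compact cg Zc.
by exists (M + 1) => x Zx; apply: hM; [rewrite ltrDl|exists x].
Qed.

Lemma Rintegral_model_lipschitz : exists2 L, 0 <= L &
  forall a (g g' : 'rV[R]_u -> R) eta, K a ->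
  {within Z, continuous g} -> {within Z, continuous g'} ->
  (forall x, Z x -> `|g x - g' x| <= eta) ->
  `|\int[mu]_(x in Z) (F a x * g x) - \int[mu]_(x in Z) (F a x * g' x)| <= eta * L.
Proof.
exists (\int[mu]_x DZ x); first by rewrite Rintegral_ge0.
move=> a g g' eta Ka cg cg' gg'.
have iF h : {within Z, continuous h} ->
    mu.-integrable setT (EFin \o (fun x => FZ a x * gZ h x)).
  move=> ch; have [B hB] := within_continuous_bounded ch.
  apply: (@integrable_FZM _ _ B) => // [|x Zx]; first exact: mgZ.
  by rewrite gZE//; exact: hB.
rewrite !Rintegral_FZ -RintegralB//; [|exact: iF..].
under eq_Rintegral do rewrite -mulrBr.
apply: Rintegral_FZM_le => // [|x Zx]; first by apply: measurable_funB; exact: mgZ.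
by rewrite !gZE//; exact: gg'.
Qed.

Lemma Rintegral_model_continuous (g : 'rV[R]_u -> R) : {within Z, continuous g} ->
  eps_delta_continuous_on K (fun a => \int[mu]_(x in Z) (F a x * g x)).
Proof.
move=> cg; have [C hC] := within_continuous_bounded cg.
rewrite (_ : (fun a => _) = fun a => \int[mu]_x (FZ a x * gZ g x)); last first.
  by apply/funext => a; exact: Rintegral_FZ.
have gZC x : Z x -> `|gZ g x| <= C by move=> Zx; rewrite gZE//; exact: hC.
apply: (@dominated_Rintegral_continuous _ _ _ mu _ K (fun a x => FZ a x * gZ g x) (fun x => C * DZ x)).
- by move=> a Ka; apply: measurable_funM; [exact: mFZ|exact: mgZ].
- move=> x a Ka e e0; have gx0 : 0 < 1 + `|gZ g x| by rewrite ltr_pwDl.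
  have [dl dl0 hdl] := @cFZ x a Ka _ (divr_gt0 e0 gx0).
  exists dl => // b Kb ba; rewrite -mulrBl normrM.
  have := hdl b Kb ba; rewrite ltr_pdivlMr//; apply: le_lt_trans.
  by rewrite ler_wpM2l// lerDr.
- by move=> a x Ka; exact: FZM_le.
- exact: integrable_scaleR.
Qed.

Variable X : nat -> Omega -> Borel 'rV[R]_u.
Hypothesis mX : forall j, measurable_fun setT (X j).
Hypothesis XZ : forall j w, Z (X j w).
Hypothesis law : forall j B, measurable B -> P (X j @^-1` B) = mu B.
Hypothesis indX : forall i j A A', i != j -> measurable A -> measurable A' ->
    P (X i @^-1` A `&` X j @^-1` A') = (P (X i @^-1` A) * P (X j @^-1` A'))%E.

(** Replacing [g] by a step function within [eta] changes the empirical average by at most [eta]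
    times the average of [DZ]. The envelope therefore needs its own law of large numbers besides
    those of the cells. *)
Lemma empirical_averages_cvg : {ae P, forall w, forall g : 'rV[R]_u -> R,
  {within Z, continuous g} -> forall eps : R, 0 < eps ->
  \forall m \near \oo, forall a, K a ->
    `|(\sum_(j < m) F a (X j w) * g (X j w)) / m%:R -
      \int[mu]_(x in Z) (F a x * g x)| <= eps}.
Proof.
have /choice[s /choice[c /choice[C hC]]] N : exists (s : nat) (c : nat -> 'rV[R]_u)
    (C : nat -> set (Borel 'rV[R]_u)),
  [/\ forall i, measurable (C i), forall i, (i < s)%N -> Z (c i) &
    forall x, Z x -> exists i : 'I_s, `|x - c i| < N.+1%:R^-1 /\
      forall h : nat -> R, \sum_(j < s) h j * \1_(C j) x = h i].
  by apply: small_partition => //; rewrite invr_gt0.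
pose fC N i a x := FZ a x * \1_(C N i) x.
have mC N i : measurable (C N i) by case: (hC N).
have mind N i : measurable_fun setT (\1_(C N i) : Borel 'rV[R]_u -> R) by exact: measurable_indic.
have ind1 N i x : `|\1_(C N i) x : R| <= 1 by rewrite indicE; case: (_ \in _); rewrite ?normr1 ?normr0.
have aeC : {ae P, forall w, forall N i, forall eps : R, 0 < eps ->
    \forall m \near \oo, forall a, K a ->
    `|(\sum_(j < m) (fC N i a (X j w) - \int[mu]_s fC N i a s)) / m%:R| <= eps}.
  apply: ae_foralln => N; apply: ae_foralln => i.
  apply: (uniform_slln_identically_distributed mX law Kc _ _ _ iDZ) => //.
  - by move=> a Ka; apply: measurable_funM => //; exact: mFZ.
  - move=> x a Ka e e0; have [dl dl0 hdl] := @cFZ x a Ka _ e0.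
    exists dl => // b Kb ba; rewrite /fC -mulrBl normrM.
    by apply: le_lt_trans (hdl b Kb ba); rewrite ler_piMr.
  - by move=> a x Ka; rewrite -[leRHS]mul1r; apply: FZM_le.
(* The ordinary law for [DZ] is the uniform one over a one-point parameter set in dimension [0]. *)
have aeD : {ae P, forall w, forall eps : R, 0 < eps ->
    \forall m \near \oo, forall a, [set (0 : 'rV[R]_0)] a ->
    `|(\sum_(j < m) (DZ (X j w) - \int[mu]_s DZ s)) / m%:R| <= eps}.
  apply: (@uniform_slln_identically_distributed _ _ _ _ _ _ _ _ mX law 0 [set 0] (fun=> DZ) DZ) => //.
  - exact: compact_set1.
  - by move=> a _; apply/measurable_EFinP; exact: (measurable_int _ iDZ).
  - by move=> x a _ e e0; exists 1 => // b _ _; rewrite subrr normr0.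
  - by move=> a x _; rewrite ger0_norm.
apply: filterS2 aeC aeD => w hw hD g cg eps eps0.
set L := \int[mu]_s DZ s in hD *.
have L0 : 0 <= L by rewrite Rintegral_ge0.
(* The three errors are [eta * (1 + L)] for the average of [g - step], [eta] for the cells and
   [eta * L] for the integral of [g - step]. *)
pose eta := eps / (2 + 2 * L).
have eta0 : 0 < eta by rewrite divr_gt0//; lra.
have epsE : eps = eta * (2 + 2 * L) by rewrite divfK// gt_eqF//; lra.
have [dl dl0 hdl] := compact_uniformly_continuous Zc (iffLR (eps_delta_continuousP _ _) cg) eta0.
pose N := Num.truncn dl^-1.
have Ndl : N.+1%:R^-1 < dl.
  by rewrite -[ltRHS]invrK ltf_pV2 ?posrE ?invr_gt0// truncnS_gt.
have [_ cZ hstep] := hC N.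
pose step x := \sum_(i < s N) g (c N i) * \1_(C N i) x.
have step_close x : Z x -> `|g x - step x| <= eta.
  move=> Zx; have [i [xi hi]] := hstep x Zx.
  rewrite /step (hi (fun j => g (c N j))) ltW// hdl//; first exact: cZ.
  exact: lt_trans Ndl.
have mstep : measurable_fun setT (step : Borel 'rV[R]_u -> R).
  by apply: measurable_sum => i; exact: measurable_funM.
have [B hB] := within_continuous_bounded cg.
have stepB x : Z x -> `|step x| <= B + eta.
  move=> Zx; have -> : step x = g x - (g x - step x) by ring.
  by apply: le_trans (ler_normB _ _) _; apply: lerD; [exact: hB|exact: step_close].
pose G := \sum_(i < s N) `|g (c N i)|.
have G0 : 0 <= G by apply: sumr_ge0.
(* Tolerance per cell: weighted by the values of [g] at the centres, these errors add up to at most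
   [eta]. *)
have etaG : 0 < eta / (1 + G) by rewrite divr_gt0// ltr_pwDl.
have nearC : \forall m \near \oo, forall i : 'I_(s N), forall a, K a ->
    `|(\sum_(j < m) (fC N i a (X j w) - \int[mu]_s fC N i a s)) / m%:R| <= eta / (1 + G).
  by apply: filter_forall => i; exact: hw.
have nearD := hD 1 ltr01.
near=> m.
have m0 : 0 < m%:R :> R by rewrite ltr0n; near: m; exists 1%N.
have mC' : forall i : 'I_(s N), forall a, K a ->
    `|(\sum_(j < m) (fC N i a (X j w) - \int[mu]_s fC N i a s)) / m%:R| <= eta / (1 + G).
  by near: m; exact: nearC.
have mD : `|(\sum_(j < m) (DZ (X j w) - L)) / m%:R| <= 1.
  have h : forall a, [set (0 : 'rV[R]_0)] a -> `|(\sum_(j < m) (DZ (X j w) - L)) / m%:R| <= 1.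
    by near: m; exact: nearD.
  exact: (h 0).
have avgB (h : Borel 'rV[R]_u -> R) r : (\sum_(j < m) (h (X j w) - r)) / m%:R =
    (\sum_(j < m) h (X j w)) / m%:R - r.
  by rewrite sumrB sumr_const card_ord mulrBl -(mulr_natr r) mulfK ?gt_eqF.
rewrite avgB in mD.
have {}mD : (\sum_(j < m) DZ (X j w)) / m%:R <= 1 + L.
  by rewrite -lerBlDr (le_trans (ler_norm _)).
move=> a Ka; rewrite Rintegral_FZ.
have iFs : mu.-integrable setT (EFin \o (fun x => FZ a x * step x)).
  exact: (integrable_FZM Ka mstep stepB).
have iFg : mu.-integrable setT (EFin \o (fun x => FZ a x * gZ g x)).
  apply: (@integrable_FZM _ _ B) => // [|x Zx]; first exact: mgZ.
  by rewrite gZE//; exact: hB.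
have h1 : `|(\sum_(j < m) F a (X j w) * g (X j w)) / m%:R -
    (\sum_(j < m) FZ a (X j w) * step (X j w)) / m%:R| <= eta * (1 + L).
  rewrite -mulrBl -sumrB normrM normfV (gtr0_norm m0) ler_pdivrMr//.
  apply: le_trans (ler_norm_sum _ _ _) _.
  apply: (@le_trans _ _ (\sum_(j < m) eta * DZ (X j w))).
    apply: ler_sum => j _.
    rewrite (_ : F a (X j w) = FZ a (X j w)); last by rewrite /FZ patchE mem_set.
    by rewrite -mulrBr; exact: (FZM_le Ka step_close).
  by rewrite -mulr_sumr -[leRHS]mulrA (ler_pM2l eta0) -ler_pdivrMr.
have h3 : `|\int[mu]_x (FZ a x * step x) - \int[mu]_x (FZ a x * gZ g x)| <= eta * L.
  rewrite -RintegralB//; under eq_Rintegral do rewrite -mulrBr.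
  apply: Rintegral_FZM_le => // [|x Zx]; first by apply: measurable_funB => //; exact: mgZ.
  by rewrite gZE// distrC; exact: step_close.
have h2 : `|(\sum_(j < m) FZ a (X j w) * step (X j w)) / m%:R -
    \int[mu]_x (FZ a x * step x)| <= eta.
  have ifC (i : 'I_(s N)) : mu.-integrable setT (EFin \o (fun x => g (c N i) * fC N i a x)).
    by apply: integrable_scaleR; apply: (@integrable_FZM _ _ 1).
  have -> : \int[mu]_x (FZ a x * step x) = \sum_(i < s N) g (c N i) * \int[mu]_x fC N i a x.
    rewrite (@eq_Rintegral _ _ _ mu setT (fun x => \sum_(i < s N) g (c N i) * fC N i a x)); last first.
      by move=> x _; rewrite /step mulr_sumr; apply: eq_bigr => i _; rewrite /fC mulrCA.
    rewrite Rintegral_sum//; apply: eq_bigr => i _; rewrite RintegralZl//.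
    by apply: (@integrable_FZM _ _ 1).
  have -> : (\sum_(j < m) FZ a (X j w) * step (X j w)) / m%:R =
      \sum_(i < s N) g (c N i) * ((\sum_(j < m) fC N i a (X j w)) / m%:R).
    rewrite mulr_suml; under eq_bigr do rewrite /step mulr_sumr mulr_suml.
    rewrite exchange_big/=; apply: eq_bigr => i _.
    rewrite mulr_suml mulr_sumr; apply: eq_bigr => j _.
    by rewrite /fC; ring.
  rewrite -sumrB; apply: le_trans (ler_norm_sum _ _ _) _.
  apply: (@le_trans _ _ (\sum_(i < s N) `|g (c N i)| * (eta / (1 + G)))).
    apply: ler_sum => i _; rewrite -mulrBr normrM ler_wpM2l// -avgB.
    exact: mC'.
  rewrite -mulr_suml mulrA ler_pdivrMr; last by rewrite ltr_pwDl.
  by rewrite mulrC ler_wpM2l ?(ltW eta0)// lerDr.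
set x1 := (\sum_(j < m) F a (X j w) * g (X j w)) / m%:R in h1 *.
set x2 := (\sum_(j < m) FZ a (X j w) * step (X j w)) / m%:R in h1 h2 *.
set x3 := \int[mu]_x (FZ a x * step x) in h2 h3 *.
set x4 := \int[mu]_x (FZ a x * gZ g x) in h3 *.
have -> : x1 - x4 = (x1 - x2) + (x2 - x3) + (x3 - x4) by ring.
apply: le_trans (ler_normD _ _) _; apply: le_trans (lerD (ler_normD _ _) (lexx _)) _.
by rewrite epsE; lra.
Unshelve. all: by end_near. Qed.

Lemma empirical_noise_cvg (E : nat -> Omega -> R) (r M : R) :
  (forall j, measurable_fun setT (E j)) -> 1 < r <= 2 ->
  (forall j, (\int[P]_w (`|E j w| `^ r)%:E <= M%:E)%E) ->
  (forall j, P.-integrable setT (EFin \o E j)) ->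
  (forall j, \int[P]_w E j w = 0) ->
  (forall j A B, measurable A -> measurable B ->
    P (X j @^-1` A `&` E j @^-1` B) = (P (X j @^-1` A) * P (E j @^-1` B))%E) ->
  (forall i j A B A' B', i != j ->
    measurable A -> measurable B -> measurable A' -> measurable B' ->
    P ((X i @^-1` A `&` E i @^-1` B) `&` (X j @^-1` A' `&` E j @^-1` B')) =
    (P (X i @^-1` A `&` E i @^-1` B) * P (X j @^-1` A' `&` E j @^-1` B'))%E) ->
  {ae P, forall w, forall eps : R, 0 < eps -> \forall m \near \oo, forall a, K a ->
    `|(\sum_(j < m) F a (X j w) * E j w) / m%:R| <= eps}.
Proof.
move=> mE r12 EM iE E0 ind1 ind2.
have := uniform_slln_centered_weights mX law Kc mFZ cFZ FDZ iDZ mE r12 EM iE E0 ind1 ind2.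
apply: filterS => w h eps /h; apply: filterS => m hm a /hm.
congr (`|_ / _| <= _); apply: eq_bigr => j _.
by rewrite /FZ patchE mem_set.
Qed.

End random_design.

(** * Parameters, moments and independence of the observations *)

Section row_vectors.
Variable R : realType.

Lemma rV_norm_lt n (x : 'rV[R]_n) e : 0 < e -> (forall j, `|x ord0 j| < e) -> `|x| < e.
Proof.
move=> e0 h; have : ball 0 e x.
  split => // i j; rewrite ord1.
  suff : `|(0 : 'rV[R]_n) ord0 j - x ord0 j| < e by [].
  by rewrite mxE sub0r normrN.
by rewrite mx_norm_ball /ball_/= sub0r normrN.
Qed.

Lemma rV_coord_le n (x : 'rV[R]_n) j : `|x ord0 j| <= `|x|.
Proof.
apply/ler_addgt0Pr => e e0.
have : ball 0 (`|x| + e) x by rewrite mx_norm_ball /ball_/= sub0r normrN ltrDl.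
case=> _ /(_ ord0 j) h; apply: ltW.
have {}h : `|(0 : 'rV[R]_n) ord0 j - x ord0 j| < `|x| + e by exact: h.
by move: h; rewrite mxE sub0r normrN.
Qed.

Lemma submxrow_norm_le q (v : 'I_q -> nat) (x : 'rV[R]_(\sum_l v l)) l :
  `|submxrow x l| <= `|x|.
Proof.
apply/ler_addgt0Pr => e e0; apply/ltW/rV_norm_lt; first by rewrite ltr_wpDl.
by move=> j; rewrite mxE; apply: le_lt_trans (rV_coord_le _ _) _; rewrite ltrDl.
Qed.

Lemma submxrow_continuous q (v : 'I_q -> nat) l :
  continuous (fun x : 'rV[R]_(\sum_l v l) => submxrow x l).
Proof.
move=> x; apply/(@cvgrPdist_lt _ _ _ (nbhs x) (nbhs_filter x)) => e e0.
apply: filterS (nbhsx_ballx x e e0) => y; rewrite mx_norm_ball /ball_/=.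
apply: le_lt_trans; rewrite (_ : _ - _ = submxrow (x - y) l) ?submxrow_norm_le//.
by apply/rowP => j; rewrite !mxE.
Qed.

Lemma param_set_compact q (v : 'I_q.+1 -> nat) (Wl : forall l, set 'rV[R]_(v l)) :
  (forall l, compact (Wl l)) -> compact (param_set Wl).
Proof.
move=> Wc.
have /choice[M hM] l : exists M : R, forall a, Wl l a -> `|a| <= M.
  have /compact_bounded[M [_ h]] := Wc l.
  by exists (M + 1) => a; apply: h; rewrite ltrDl.
apply: bounded_closed_compact.
  exists (\sum_l `|M l|); split; first exact: num_real.
  move=> B MB w Ww; apply/ltW.
  have B0 : 0 < B by apply: le_lt_trans MB; exact: sumr_ge0.
  apply: rV_norm_lt => // j; apply: le_lt_trans MB.
  rewrite -[w]submxrowK mxE; apply: le_trans (rV_coord_le _ _) _.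
  apply: le_trans (hM _ _ (Ww _)) _; rewrite (bigD1 (tagnat.sig1 j))//=.
  by apply: le_trans (ler_norm _) _; rewrite lerDl sumr_ge0.
have -> : param_set Wl = \bigcap_l (fun x => submxrow x l) @^-1` Wl l.
  by apply/seteqP; split => [w h l _|w h l]; [exact: h|exact: (h l)].
apply: closed_bigI => l _; apply: preimage_closed; last exact: compact_rV_closed.
by move=> x _; exact: submxrow_continuous.
Qed.

End row_vectors.

Section moments.
Context d (T : measurableType d) (R : realType).

(** The dominating function is [1 + |f|^p], integrable because the measure is finite. *)
Lemma integrable_of_Lp (mu : {finite_measure set T -> \bar R}) (A : set T)
    (f : T -> R) (p : R) :
  measurable A -> measurable_fun A f -> 1 <= p ->
  (\int[mu]_(x in A) (`|f x| `^ p)%:E < +oo)%E -> mu.-integrable A (EFin \o f).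
Proof.
move=> mA mf p1 fp.
have mfp : measurable_fun A (fun x => `|f x| `^ p).
  by apply: (measurableT_comp (measurable_powR p)); exact: measurableT_comp.
have ifp : mu.-integrable A (EFin \o (fun x => `|f x| `^ p)).
  apply/integrableP; split; first exact/measurable_EFinP.
  by under eq_integral => x _ do rewrite /= ger0_norm ?powR_ge0//.
pose one : T -> R := cst 1.
have i1 : mu.-integrable A (EFin \o one).
  by apply: finite_measure_integrable_cst.
have isum : mu.-integrable A ((EFin \o one) \+ (EFin \o (fun x => (`|f x| `^ p)%R)))%E.
  exact: integrableD.
apply: (le_integrable mA _ _ isum); first exact/measurable_EFinP.
move=> x _; rewrite /= lee_fin [leRHS]ger0_norm ?addr_ge0 ?powR_ge0//.
have [x1|x1] := leP `|f x| 1; first by rewrite ler_wpDr ?powR_ge0.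
rewrite ler_wpDl// -{1}(powRr1 (normr_ge0 (f x))); apply: ler_powR => //; exact: ltW.
Qed.

(** For [p = 1] the conjugate norm is the essential supremum, and [r = 2] works. For [p > 1] the
    conjugate exponent is [q = p / (p - 1) > 1]; it is capped at [2] because the truncation bound
    uses the power [2 - r], and the lower moment is controlled by [1 + |x|^q]. *)
Lemma moment_of_Lnorm_conjugate (P : probability T R) (p M : R) (E : nat -> T -> R) :
  1 <= p -> (forall j, measurable_fun setT (E j)) ->
  (forall j, (Lnorm P (hoelder_conjugate p%:E) (EFin \o E j) <= M%:E)%E) ->
  exists r C : R, 1 < r <= 2 /\ forall j, (\int[P]_w (`|E j w| `^ r)%:E <= C%:E)%E.
Proof.
rewrite le_eqVlt => /predU1P[<-|p1] mE EM.
  exists 2, (`|M| `^ 2); split; first by rewrite ltr1n lexx.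
  move=> j; have := EM j; rewrite hoelder_conjugate1 unlock; case: ifPn => [_|]; last first.
    (* The norm of infinite exponent is defined by cases on whether the total mass is positive; here
       it is [1]. *)
    by rewrite [X in (0 < X)%E](_ : _ = 1%E) ?lte01//; exact: probability_setT.
  move=> /ess_supP aeM.
  apply: (@le_trans _ _ (\int[P]_w (`|M| `^ 2)%:E)%E); last first.
    by rewrite integral_cst//= probability_setT mule1.
  apply: ae_ge0_le_integral => //.
  - apply/measurable_EFinP; apply: (measurableT_comp (measurable_powR 2)).
    exact: measurableT_comp.
  - apply: filterS aeM => w /= h _; rewrite lee_fin; apply: ge0_ler_powR; rewrite ?nnegrE//.
    by move: h; rewrite lee_fin => /le_trans; apply; exact: ler_norm.
pose q := p / (p - 1).
have p10 : 0 < p - 1 by rewrite subr_gt0.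
have q1 : 1 < q by rewrite ltr_pdivlMr// mul1r; lra.
have qE : hoelder_conjugate p%:E = q%:E.
  rewrite /hoelder_conjugate/= eqe gt_eqF ?(lt_trans ltr01 p1)//.
  by rewrite -EFinB inver gt_eqF.
have q0 : 0 < q by rewrite (lt_trans ltr01).
have EqM j : (\int[P]_w (`|E j w| `^ q)%:E <= (`|M| `^ q)%:E)%E.
  have := EM j; rewrite qE => h.
  rewrite (_ : (\int[P]_w (`|E j w| `^ q)%:E)%E = (Lnorm P q%:E (EFin \o E j) `^ q)%E); last first.
    rewrite poweR_Lnorm ?gt_eqF//.
  rewrite -poweR_EFin; apply: gt0_ler_poweR; rewrite ?(ltW q0)//.
  - by rewrite in_itv/= leey andbT Lnorm_ge0.
  - by rewrite in_itv/= leey andbT lee_fin.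
  - by apply: le_trans h _; rewrite lee_fin ler_norm.
pose r := Num.min q 2.
exists r, (1 + `|M| `^ q); split.
  by rewrite lt_min q1 ltr1n ge_min lexx orbT.
move=> j; apply: (@le_trans _ _ (\int[P]_w (1 + `|E j w| `^ q)%:E)%E).
  have mpow s : measurable_fun setT (fun w => `|E j w| `^ s).
    by apply: (measurableT_comp (measurable_powR s)); exact: measurableT_comp.
  apply: ge0_le_integral => //.
  - by apply/measurable_EFinP; exact: mpow.
  - by apply/measurable_EFinP; apply: measurable_funD => //; exact: mpow.
  - move=> w _; rewrite lee_fin; have [x1|x1] := leP `|E j w| 1.
      rewrite ler_wpDr ?powR_ge0// -(powRr0 (`|E j w|)).
      have [->|x0] := eqVneq `|E j w| 0; first by rewrite powRr0 powR0 ?ler01// gt_eqF// lt_min q0 ltr0n.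
      by apply: ger_powR; rewrite ?lt_neqAle ?(eq_sym 0) ?x0 ?normr_ge0 ?x1//= le_min (ltW q0) ler0n.
    by rewrite ler_wpDl//; apply: ler_powR; [exact: ltW|rewrite ge_min lexx].
under eq_integral do rewrite EFinD.
rewrite ge0_integralD//=.
- rewrite integral_cst//= probability_setT mule1 EFinD.
  by apply: leeD2l; exact: EqM.
- apply/measurable_EFinP; apply: (measurableT_comp (measurable_powR q)).
  exact: measurableT_comp.
Qed.

End moments.

Section independence_extraction.
Context d (Omega : measurableType d) (R : realType) (P : probability Omega R).

Lemma mutually_independent_pair (I : eqType) d' (T : measurableType d')
    (X : I -> Omega -> T) i j A B :
  mutually_independent P X -> i != j -> measurable A -> measurable B ->
  P (X i @^-1` A `&` X j @^-1` B) = (P (X i @^-1` A) * P (X j @^-1` B))%E.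
Proof.
move=> indX ij mA mB.
have := indX [:: i; j] (fun l => if l == i then A else B).
rewrite /= inE ij big_cons big_seq1 eqxx eq_sym (negbTE ij) => <- //.
  congr (P _); apply/seteqP; split => [w [Aw Bw] l|w h].
    by rewrite !inE => /orP[] /eqP->; rewrite ?eqxx// eq_sym (negbTE ij).
  split; first by have := h i (mem_head _ _); rewrite eqxx.
  by have := h j; rewrite !inE eqxx orbT eq_sym (negbTE ij); exact.
by move=> l; case: ifP.
Qed.

Lemma family_sigma_algebra_preimage (I : Type) d' (T : measurableType d')
    (X : I -> Omega -> T) i A : measurable A ->
  family_sigma_algebra X (X i @^-1` A).
Proof.
move=> mA; apply: sub_sigma_algebra; exists i => //.
by exists A => //; rewrite setTI.
Qed.

Lemma family_sigma_algebraI (I : Type) d' (T : measurableType d')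
    (X : I -> Omega -> T) A B :
  family_sigma_algebra X A -> family_sigma_algebra X B -> family_sigma_algebra X (A `&` B).
Proof.
set G := \bigcup_i preimage_set_system [set: Omega] (X i) measurable.
exact: (@measurableI _ (g_sigma_algebraType G)).
Qed.

Variables (d1 d2 : measure_display) (T1 : measurableType d1) (T2 : measurableType d2).
Variables (X : nat -> Omega -> T1) (E : nat -> Omega -> T2).
Hypothesis indXE : independent_families P E X.
Hypothesis indX : forall i j A B, i != j -> measurable A -> measurable B ->
  P (X i @^-1` A `&` X j @^-1` B) = (P (X i @^-1` A) * P (X j @^-1` B))%E.
Hypothesis indE : forall i j A B, i != j -> measurable A -> measurable B ->
  P (E i @^-1` A `&` E j @^-1` B) = (P (E i @^-1` A) * P (E j @^-1` B))%E.

Lemma independent_families_coord j A B : measurable A -> measurable B ->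
  P (X j @^-1` A `&` E j @^-1` B) = (P (X j @^-1` A) * P (E j @^-1` B))%E.
Proof.
by move=> mA mB; rewrite setIC muleC; apply: indXE; exact: family_sigma_algebra_preimage.
Qed.

(** Regrouping the four events by family, independence of the families separates the [X] events from
    the [E] events, and pairwise independence then splits each group. *)
Lemma independent_families_pairs i j A B A' B' : i != j ->
  measurable A -> measurable B -> measurable A' -> measurable B' ->
  P ((X i @^-1` A `&` E i @^-1` B) `&` (X j @^-1` A' `&` E j @^-1` B')) =
  (P (X i @^-1` A `&` E i @^-1` B) * P (X j @^-1` A' `&` E j @^-1` B'))%E.
Proof.
move=> ij mA mB mA' mB'; rewrite !independent_families_coord// setIACA setIC indXE.
- by rewrite indX// indE// muleC muleACA.
- by apply: family_sigma_algebraI; exact: family_sigma_algebra_preimage.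
- by apply: family_sigma_algebraI; exact: family_sigma_algebra_preimage.
Qed.

End independence_extraction.

(** * Regularity of the loss *)

(** Each [Q l] holds eventually as the radius decreases to [0], and such statements commute with a
    finite quantifier, including the case [k = 0]. *)
Lemma common_radius (R : realType) k (Q : 'I_k -> R -> Prop) :
  (forall l x y, 0 < y -> y <= x -> Q l x -> Q l y) ->
  (forall l, exists2 x, 0 < x & Q l x) -> exists2 x, 0 < x & forall l, Q l x.
Proof.
move=> mono ex; have : \forall x \near (0 : R)^'+, forall l, Q l x.
  apply: filter_forall => l; have [x x0 Qx] := ex l.
  near=> y.
  have y0 : 0 < y by near: y; exact: nbhs_right_gt.
  have yx : y <= x by near: y; exact: nbhs_right_ltW.
  exact: mono Qx.
move=> /(filterI (nbhs_right_gt (0 : R))) /filter_ex[x [x0 Qx]]; by exists x.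
Unshelve. all: by end_near. Qed.

Lemma cont_on_continuous (R : realType) u (Z : set 'rV[R]_u) (g : cont_on Z) :
  {within Z, continuous (g : 'rV[R]_u -> R)}.
Proof. exact: set_mem (svalP g). Qed.

Lemma near_cont_on (R : realType) u (Z : set 'rV[R]_u) (g : cont_on Z) (eta : R) :
  0 < eta -> nbhs g [set g' : cont_on Z | forall x, Z x -> `|g x - g' x| < eta].
Proof.
move=> eta0.
have cval : continuous (set_val : cont_on Z -> {uniform` Z -> R}) by exact: initial_continuous.
apply: (cval g [set h : {uniform` Z -> R} | forall x, Z x -> `|(g : 'rV[R]_u -> R) x - h x| < eta]).
apply/uniform_nbhs; exists [set xy : R * R | `|xy.1 - xy.2| < eta]; split => //.
exact: (entourage_ball _ (PosNum eta0)).
Qed.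

Section model_regularity.
Variables (R : realType) (u o k : nat) (v : 'I_k.+1 -> nat).
Variables (Z : set 'rV[R]_u) (mu : {finite_measure set (Borel 'rV[R]_u) -> \bar R}).
Hypothesis Zc : compact Z.
Variable Wl : forall l : 'I_k.+1, set 'rV[R]_(v l).
Variable F : forall l : 'I_k, 'rV[R]_(v (lift ord0 l)) -> 'rV[R]_u -> R.
Hypothesis cF : forall l x, Z x ->
  {within @Wl (lift ord0 l), continuous (fun a => @F l a x)}.
Hypothesis mF : forall l a, @Wl (lift ord0 l) a ->
  measurable_fun (Z : set (Borel 'rV[R]_u)) (@F l a : Borel 'rV[R]_u -> R).
Variable D : 'I_k -> Borel 'rV[R]_u -> R.
Hypothesis iD : forall l, mu.-integrable Z (EFin \o D l).
Hypothesis FD : forall l a x, @Wl (lift ord0 l) a -> Z x -> `|@F l a x| <= D l x.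
Variable U : 'rV[R]_(v ord0) -> 'rV[R]_k -> 'rV[R]_o.
Hypothesis cU : forall e : R, 0 < e -> exists2 delta : R, 0 < delta &
  forall a b s t, @Wl ord0 a -> @Wl ord0 b ->
    `|a - b| < delta -> `|s - t| < delta -> `|U a s - U b t| < e.

Let W := param_set Wl.
Let H := model F U Z mu.

Lemma model_continuous_param (g : 'rV[R]_u -> R) : {within Z, continuous g} ->
  forall a, W a -> forall e, 0 < e -> exists2 dl, 0 < dl &
    forall b, W b -> `|b - a| < dl -> `|H b g - H a g| < e.
Proof.
move=> cg a Wa e e0; have [d1 d10 hU] := cU e0.
have [d2 d20 hd2] : exists2 dl, 0 < dl & forall l : 'I_k,
    forall b, @Wl (lift ord0 l) b -> `|b - submxrow a (lift ord0 l)| < dl ->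
    `|\int[mu]_(x in Z) (F b x * g x) -
      \int[mu]_(x in Z) (F (submxrow a (lift ord0 l)) x * g x)| < d1.
  apply: (common_radius (Q := fun l dl => forall b, @Wl (lift ord0 l) b ->
      `|b - submxrow a (lift ord0 l)| < dl ->
    `|\int[mu]_(x in Z) (F b x * g x) -
      \int[mu]_(x in Z) (F (submxrow a (lift ord0 l)) x * g x)| < d1)) => [l x y y0 yx h b Wb ba|l].
    by apply: h => //; exact: lt_le_trans yx.
  have := Rintegral_model_continuous Zc (@cF l) (@mF l) (@iD l) (@FD l) cg.
  by move=> /(_ _ (Wa _) _ d10).
exists (Num.min d1 d2) => [|b Wb]; first by rewrite lt_min d10.
rewrite lt_min => /andP[ba1 ba2].
have sub l : submxrow b l - submxrow a l = submxrow (b - a) l.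
  by apply/rowP => j; rewrite !mxE.
apply: hU; [exact: Wb|exact: Wa|..].
  by rewrite sub; apply: le_lt_trans (submxrow_norm_le _ _) _.
apply: rV_norm_lt => // l; rewrite !mxE; apply: hd2; first exact: Wb.
by rewrite sub; apply: le_lt_trans (submxrow_norm_le _ _) _.
Qed.

(** Every feature is Lipschitz in [g] for the uniform distance on [Z]. This continuity in the
    function is what makes the loss Borel on the space of data. *)
Lemma model_continuous_fun a : W a -> forall e, 0 < e -> exists2 eta, 0 < eta &
  forall g g' : 'rV[R]_u -> R, {within Z, continuous g} -> {within Z, continuous g'} ->
    (forall x, Z x -> `|g x - g' x| <= eta) -> `|H a g - H a g'| < e.
Proof.
move=> Wa e e0; have [d1 d10 hU] := cU e0.
have [eta eta0 heta] : exists2 eta, 0 < eta & forall l : 'I_k,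
    forall g g' : 'rV[R]_u -> R, {within Z, continuous g} -> {within Z, continuous g'} ->
    (forall x, Z x -> `|g x - g' x| <= eta) ->
    `|\int[mu]_(x in Z) (F (submxrow a (lift ord0 l)) x * g x) -
      \int[mu]_(x in Z) (F (submxrow a (lift ord0 l)) x * g' x)| < d1.
  apply: (common_radius (Q := fun l eta => forall g g' : 'rV[R]_u -> R,
    {within Z, continuous g} -> {within Z, continuous g'} ->
    (forall x, Z x -> `|g x - g' x| <= eta) ->
    `|\int[mu]_(x in Z) (F (submxrow a (lift ord0 l)) x * g x) -
      \int[mu]_(x in Z) (F (submxrow a (lift ord0 l)) x * g' x)| < d1))
    => [l x y y0 yx h g g' cg cg' gg'|l].
    by apply: h => // z Zz; exact: le_trans (gg' z Zz) yx.
  have [L L0 hL] := Rintegral_model_lipschitz Zc (@mF l) (@iD l) (@FD l).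
  exists (d1 / (1 + L)) => [|g g' cg cg' gg']; first by rewrite divr_gt0// ltr_pwDl.
  apply: le_lt_trans (hL _ _ _ _ (Wa _) cg cg' gg') _.
  by rewrite -mulrA gtr_pMr// mulrC ltr_pdivrMr ?ltr_pwDl// mul1r ltrDr.
exists eta => // g g' cg cg' gg'; apply: hU; rewrite ?subrr ?normr0//; try exact: Wa.
by apply: rV_norm_lt => // l; rewrite !mxE; exact: heta.
Qed.

Variable c : 'rV[R]_o -> 'rV[R]_o -> R.
Hypothesis cc : continuous (fun st : 'rV[R]_o * 'rV[R]_o => c st.1 st.2).

Lemma loss_eps_delta (t s : 'rV[R]_o) e : 0 < e -> exists2 dl, 0 < dl &
  forall t' s' : 'rV[R]_o, `|t - t'| < dl -> `|s - s'| < dl -> `|c t s - c t' s'| < e.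
Proof.
move=> e0; have /cvgrPdist_lt/(_ e e0) := @cc (t, s).
move=> /nbhs_ballP[dl /= dl0 h]; exists dl => // t' s' tt' ss'.
by apply: (h (t', s')); split; rewrite /= mx_norm_ball.
Qed.

Lemma loss_continuous_param t (g : 'rV[R]_u -> R) : {within Z, continuous g} ->
  eps_delta_continuous_on W (fun w => c t (H w g)).
Proof.
move=> cg a Wa e e0; have [d1 d10 h1] := loss_eps_delta t (H a g) e0.
have [dl dl0 hdl] := model_continuous_param cg Wa d10.
exists dl => // b Wb ba; rewrite distrC; apply: h1; first by rewrite subrr normr0.
by rewrite distrC; exact: hdl.
Qed.

(** The loss is jointly continuous for the uniform topology on functions and the usual one on
    targets, and the data space carries the Borel sigma-algebra of exactly this product topology. *)
Lemma loss_measurable a : W a ->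
  measurable_fun setT ((fun gt : cont_on Z * 'rV[R]_o => c gt.2 (H a gt.1)) :
    Borel (cont_on Z * 'rV[R]_o)%type -> R).
Proof.
move=> Wa; apply: (@continuous_Borel R (cont_on Z * 'rV[R]_o)%type).
move=> [g t]; apply/cvgrPdist_lt => e e0.
have [d1 d10 h1] := loss_eps_delta t (H a (cont_on_fun g)) e0.
have [eta eta0 heta] := model_continuous_fun Wa d10.
exists ([set g' : cont_on Z | forall x, Z x -> `|cont_on_fun g x - cont_on_fun g' x| < eta],
    [set t' | `|t - t'| < d1]).
  split; first exact: near_cont_on.
  by apply: filterS (nbhsx_ballx t d1 d10) => t'; rewrite mx_norm_ball.
move=> [g' t'] [/= hg ht]; apply: h1 => //.
apply: heta => [||x Zx]; [exact: cont_on_continuous|exact: cont_on_continuous|].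
exact/ltW/hg.
Qed.

Hypothesis U_bounded : exists M : R, forall a s, @Wl ord0 a -> `|U a s| <= M.

(** The features themselves range over an unbounded set. Boundedness of [U] confines the outputs to
    a compact ball, on which [c t] is uniformly continuous, so [dl] depends on neither the parameter
    nor the features. *)
Lemma loss_close_of_features t e : 0 < e -> exists2 dl : R, 0 < dl &
  forall a (s s' : 'rV[R]_k), @Wl ord0 a -> (forall l, `|s ord0 l - s' ord0 l| < dl) ->
    `|c t (U a s) - c t (U a s')| <= e.
Proof.
move=> e0; have [M hM] := U_bounded.
have Bc : compact [set s : 'rV[R]_o | `|s| <= M].
  apply: bounded_closed_compact.
    by exists M; split; [exact: num_real|move=> x Mx s /= sM; rewrite (le_trans sM)// ltW].
  rewrite (_ : mkset _ = (fun s : 'rV[R]_o => `|s|) @^-1` [set x | x <= M])//.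
  by apply: preimage_closed; [move=> s _; exact: norm_continuous|exact: closed_le].
have cct : eps_delta_continuous_on [set s : 'rV[R]_o | `|s| <= M] (c t).
  move=> s _ e1 e10; have [dl dl0 h] := loss_eps_delta t s e10.
  by exists dl => // s' _ ss'; rewrite distrC; apply: h; rewrite ?subrr ?normr0// distrC.
have [d1 d10 h1] := compact_uniformly_continuous Bc cct e0.
have [d2 d20 h2] := cU d10.
exists d2 => // a s s' Wa ss'; apply/ltW/h1; [exact: hM|exact: hM|].
apply: h2 => //; first by rewrite subrr normr0.
by apply: rV_norm_lt => // l; rewrite !mxE.
Qed.

End model_regularity.

(** * The iterated limit and the stability of minimizers *)

Lemma limsup_sizes_cvg0 (R : realType) (f : nat -> (nat -> nat) -> \bar R) :
  (forall n m, 0 <= f n m)%E ->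
  (forall eps : R, 0 < eps -> exists N, forall n, (N <= n)%N ->
    exists M, forall m, (forall i, (i < n)%N -> (M <= m i)%N) -> (f n m <= eps%:E)%E) ->
  limsup_sizes n (f n) @[n --> \oo] --> 0%E.
Proof.
move=> f0 h.
have L0 n : (0 <= limsup_sizes n (f n))%E.
  apply: le_ereal_inf_tmp => _ [M _ <-].
  (* The constant sizes [M] witness that the supremum is not over an empty set, where it would be
     [-oo]. *)
  by apply: le_trans (f0 n (fun=> M)) _; apply: ereal_sup_ubound; exists (fun=> M).
have Le eps : 0 < eps -> \forall n \near \oo, (limsup_sizes n (f n) <= eps%:E)%E.
  move=> eps0; have [N hN] := h eps eps0; exists N => // n /= Nn.
  have [M hM] := hN n Nn.
  apply: (@le_trans _ _ (ereal_sup (f n @` [set m | forall i, (i < n)%N -> (M <= m i)%N]))).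
    by apply: ereal_inf_lbound; exists M.
  by apply: ge_ereal_sup => _ [m /= hm <-]; exact: hM.
have fin : \forall n \near \oo, limsup_sizes n (f n) \is a fin_num.
  by apply: filterS (Le 1 ltr01) => n hn; rewrite ge0_fin_numE// (le_lt_trans hn)// ltry.
apply/fine_cvgP; split => //; apply/cvgr0Pnorm_le => eps eps0.
near=> n; have fn : limsup_sizes n (f n) \is a fin_num by near: n.
rewrite /= ger0_norm ?fine_ge0// -lee_fin fineK//.
by near: n; exact: Le.
Unshelve. all: by end_near. Qed.

(** The points of [W] at distance at least [eps] from every minimizer form a compact set containing
    no minimizer, so the minimum of [lam] on it exceeds the minimum on [W]. *)
Lemma near_minimizers (R : realType) n (W : set 'rV[R]_n) (lam : 'rV[R]_n -> R) eps :
  compact W -> eps_delta_continuous_on W lam -> 0 < eps ->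
  exists2 eta, 0 < eta & forall w, W w -> (forall w', W w' -> lam w <= lam w' + eta) ->
    exists2 a, minimizers W lam a & `|w - a| < eps.
Proof.
move=> Wc clam eps0.
have [W0|/set0P/negP/negPn/eqP W0] := pselect (W !=set0); last by exists 1 => // w; rewrite W0.
have [a aW ha] := compact_EVT_min W0 Wc (iffRL (eps_delta_continuousP _ _) clam).
have Wa : W a by exact: set_mem.
have amin : minimizers W lam a by split => // w' Ww'; apply: ha; exact: mem_set.
pose far := W `&` [set w | forall b, minimizers W lam b -> eps <= `|w - b|].
have farc : compact far.
  apply: compact_closedI => //.
  rewrite (_ : mkset _ = \bigcap_(b in minimizers W lam) ~` ball b eps).
    by apply: closed_bigI => b _; apply: open_closedC; exact: ball_open.
  rewrite mx_norm_ball; apply/seteqP; split => w h b /h; rewrite /ball_/= distrC leNgt.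
    by move=> /negP.
  by move/negP.
have [far0|/set0P/negP/negPn/eqP far0] := pselect (far !=set0); last first.
  exists 1 => // w Ww _; apply: contrapT => h.
  suff : far w by rewrite far0.
  split => // b bmin; rewrite leNgt; apply/negP => wb; apply: h; by exists b.
have cfar : {within far, continuous lam}.
  apply: continuous_subspaceW (iffRL (eps_delta_continuousP _ _) clam).
  by move=> w [].
have [b bfar hb] := compact_EVT_min far0 farc cfar.
have [Wb bfar'] := set_mem bfar.
have lamab : lam a < lam b.
  rewrite lt_neqAle (proj2 amin _ Wb) andbT; apply/negP => /eqP ab.
  have bmin : minimizers W lam b by split => // w' Ww'; rewrite -ab; exact: (proj2 amin).
  by have := bfar' b bmin; rewrite subrr normr0 leNgt eps0.
(* Half the gap: a value of at most [lam a + eta] stays below [lam b], the minimum over [far]. *)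
exists ((lam b - lam a) / 2) => [|w Ww hw]; first by rewrite divr_gt0// subr_gt0.
apply: contrapT => h.
have fw : far w.
  split => // b' bmin; rewrite leNgt; apply/negP => wb; apply: h; by exists b'.
have := hb w (mem_set fw); have := hw a Wa; lra.
Qed.

(* Replaces [B] by a measurable bound: the function [cmax] of the theorem need
   not be measurable. *)

Lemma measurable_envelope (R : realType) n (K : set 'rV[R]_n) dS
    (S : measurableType dS) (f : 'rV[R]_n -> S -> R) (B : S -> R) :
  K !=set0 -> (forall a, K a -> measurable_fun setT (f a)) ->
  (forall s, eps_delta_continuous_on K (f ^~ s)) ->
  (forall a s, K a -> `|f a s| <= B s) ->
  exists D : S -> R, [/\ measurable_fun setT D, forall s, 0 <= D s <= B s &
    forall a s, K a -> `|f a s| <= D s].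
Proof.
move=> K0 mf cf fB; have [q Kq dq] := dense_sequence K0.
(* A countable supremum is measurable and stays below [B]; continuity in the parameter extends its
   bound from the dense sequence to all of [K]. *)
pose u k s := `|f (q k) s|.
have uB k s : u k s <= B s by exact: fB.
have uD k s : u k s <= sups (fun k => u k s) 0.
  by apply: ub_le_sup; [exists (B s) => _ [i _ <-]|exists k].
exists (fun s => sups (fun k => u k s) 0); split.
- apply: measurable_fun_sups => [s _|k]; first by exists (B s) => _ [i _ <-].
  by apply: measurableT_comp => //; exact: mf.
- move=> s; rewrite (le_trans (normr_ge0 _) (uD 0 s))/=.
  apply: ge_sup; first by exists (u 0 s); exists 0%N.
  by move=> _ [i _ <-].
move=> a s Ka; apply/ler_addgt0Pr => e e0.
have [dl dl0 hdl] := cf s a Ka e e0.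
have [k qka] := dq a Ka dl dl0.
have -> : f a s = f (q k) s - (f (q k) s - f a s) by rewrite opprB addrC subrK.
apply: le_trans (ler_normB _ _) _; apply: lerD; first exact: uD.
exact/ltW/hdl.
Qed.

Theorem theorem8
  (R : realType) (d : measure_display) (Omega : measurableType d)
  (P : probability Omega R)
  (u o k : nat) (v : 'I_k.+1 -> nat)
  (* functional data *)
  (Z : set 'rV[R]_u) (Z_compact : compact Z)
  (G : nat -> Omega -> cont_on Z) (T : nat -> Omega -> 'rV[R]_o)
  (GT : nat -> Omega -> Borel (cont_on Z * 'rV[R]_o)%type :=
    fun i omega => (G i omega, T i omega))
  (GT_measurable : forall i, measurable_fun [set: Omega] (GT i))
  (GT_independent : mutually_independent P GT)
  (GT_identical : identically_distributed P GT)
  (* parametric model; mu lives on R^u and is carried by Z *)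
  (mu : {finite_measure set (Borel 'rV[R]_u) -> \bar R})
  (mu_carried : mu (~` Z) = 0%E)
  (Wl : forall l : 'I_k.+1, set 'rV[R]_(v l))
  (Wl_compact : forall l, compact (Wl l))
  (F : forall l : 'I_k, 'rV[R]_(v (lift ord0 l)) -> 'rV[R]_u -> R)
  (F_continuous : forall l x, Z x ->
    {within Wl (lift ord0 l), continuous (fun a => F l a x)})
  (F_measurable : forall l a, Wl (lift ord0 l) a ->
    measurable_fun (Z : set (Borel 'rV[R]_u)) (F l a : Borel 'rV[R]_u -> R))
  (p : R) (p_ge1 : 1 <= p)
  (D : 'I_k -> Borel 'rV[R]_u -> R)
  (D_measurable : forall l, measurable_fun (Z : set (Borel 'rV[R]_u)) (D l))
  (D_Lp : forall l, (\int[mu]_(x in Z) (`|D l x| `^ p)%:E < +oo)%E)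
  (F_bound : forall l a x, Wl (lift ord0 l) a -> Z x -> `|F l a x| <= D l x)
  (U : 'rV[R]_(v ord0) -> 'rV[R]_k -> 'rV[R]_o)
  (U_unif_continuous : forall e : R, 0 < e -> exists2 delta : R, 0 < delta &
    forall a b s t, Wl ord0 a -> Wl ord0 b ->
      `|a - b| < delta -> `|s - t| < delta -> `|U a s - U b t| < e)
  (U_bounded : exists M : R, forall a s, Wl ord0 a -> `|U a s| <= M)
  (W := param_set Wl) (H := model F U Z mu)
  (* error and domination *)
  (c : 'rV[R]_o -> 'rV[R]_o -> R)
  (c_continuous : continuous (fun st : 'rV[R]_o * 'rV[R]_o => c st.1 st.2))
  (c_ge0 : forall s t, 0 <= c s t)
  (cmax : 'rV[R]_o -> R) (cmax_ge0 : forall t, 0 <= cmax t)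
  (c_bound : forall w (g : cont_on Z) t, W w -> c t (H w g) <= cmax t)
  (cmax_integrable : P.-integrable [set: Omega] (EFin \o cmax \o T 0%N))
  (* observations *)
  (X : nat -> nat -> Omega -> Borel 'rV[R]_u)
  (X_measurable : forall i j, measurable_fun [set: Omega] (X i j))
  (X_in_Z : forall i j omega, Z (X i j omega))
  (X_independent : mutually_independent P (fun ij : nat * nat => X ij.1 ij.2))
  (X_law : forall i j B, measurable B -> P (X i j @^-1` B) = mu B)
  (E : nat -> nat -> {RV P >-> R})
  (E_independent : mutually_independent P
    (fun ij : nat * nat => E ij.1 ij.2 : Omega -> R))
  (E_X_independent : forall i,
    independent_families P (fun j => E i j : Omega -> R) (X i))
  (E_centered : forall i j, ('E_P[E i j] = 0)%E)
  (E_Lq : forall i, exists M : R, forall j,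
    (Lnorm P (hoelder_conjugate p%:E) (EFin \o E i j) <= M%:E)%E)
  (Y : nat -> nat -> Omega -> R :=
    fun i j omega => G i omega (X i j omega) + E i j omega)
  (* minimizers *)
  (Wstar := minimizers W
    (fun w => 'E_P[fun omega => c (T 0%N omega) (H w (G 0%N omega))]%E))
  (w : nat -> (nat -> nat) -> Omega -> 'rV[R]_(\sum_l v l))
  (w_minimizer : forall n m omega,
    (0 < n)%N -> (forall i, (i < n)%N -> (0 < m i)%N) ->
    minimizers W (empirical_error F U c n m (T ^~ omega)
      (fun i j => X i j omega) (fun i j => Y i j omega)) (w n m omega)) :
  {ae P, forall omega,
    limsup_sizes n (fun m => edist_inf Wstar (w n m omega)) @[n --> \oo]
      --> 0%E}.
Proof.
have [W0|W0] := pselect (W !=set0); last first.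
  (* The minimizer assumed for [n = 1] and sizes [1] already belongs to [W]. *)
  apply: aeW => omega; exfalso; apply: W0.
  have [Ww _] := w_minimizer 1%N (fun=> 1%N) omega isT (fun _ _ => isT).
  by eexists; exact: Ww.
have Wc : compact W by exact: param_set_compact.
have mZ : measurable (Z : set (Borel 'rV[R]_u)).
  by apply: closed_Borel; exact: compact_rV_closed.
have iD l : mu.-integrable Z (EFin \o D l).
  exact: (integrable_of_Lp mZ (D_measurable l) p_ge1 (D_Lp l)).
have cG i omega : {within Z, continuous (G i omega : 'rV[R]_u -> R)}.
  exact: cont_on_continuous.
have inner : {ae P, forall omega, forall i (l : 'I_k), forall eps : R, 0 < eps ->
    \forall m \near \oo, forall a, Wl (lift ord0 l) a ->
    `|(\sum_(j < m) F l a (X i j omega) * Y i j omega) / m%:R -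
      \int[mu]_(x in Z) (F l a x * G i omega x)| <= eps}.
  apply: ae_foralln => i; apply: filter_forall => l.
  have indX j j' A B : j != j' -> measurable A -> measurable B ->
      P (X i j @^-1` A `&` X i j' @^-1` B) = (P (X i j @^-1` A) * P (X i j' @^-1` B))%E.
    move=> jj'; apply: (mutually_independent_pair (i := (i, j)) (j := (i, j')) X_independent).
    by rewrite xpair_eqE eqxx.
  have indE j j' A B : j != j' -> measurable A -> measurable B ->
      P (E i j @^-1` A `&` E i j' @^-1` B) = (P (E i j @^-1` A) * P (E i j' @^-1` B))%E.
    move=> jj'; apply: (mutually_independent_pair (i := (i, j)) (j := (i, j')) E_independent).
    by rewrite xpair_eqE eqxx.
  have mE j : measurable_fun setT (E i j) by exact: measurable_funPT.
  have [M EM] := E_Lq i.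
  have [r [C [r12 EC]]] := moment_of_Lnorm_conjugate p_ge1 mE EM.
  have [r1 _] := andP r12.
  have iE j : P.-integrable setT (EFin \o E i j).
    by apply: (integrable_of_Lp measurableT (mE j) (ltW r1)); apply: le_lt_trans (EC j) (ltry _).
  have E0 j : \int[P]_omega E i j omega = 0.
    by have := E_centered i j; rewrite unlock /Rintegral => ->.
  have := empirical_averages_cvg Z_compact (Wl_compact (lift ord0 l)) (F_continuous l)
    (F_measurable l) (iD l) (F_bound l) (X_measurable i) (X_in_Z i) (X_law i) indX.
  have := empirical_noise_cvg Z_compact (Wl_compact (lift ord0 l)) (F_continuous l)
    (F_measurable l) (iD l) (F_bound l) (X_measurable i) (X_in_Z i) (X_law i) mE r12 EC iE E0
    (independent_families_coord (E_X_independent i))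
    (independent_families_pairs (E_X_independent i) indX indE).
  apply: filterS2 => omega noise avg eps eps0.
  have e2 : 0 < eps / 2 by rewrite divr_gt0.
  (* The null set behind [avg] was fixed before any function was chosen, so the random function
     [G i omega] may be inserted. *)
  have := avg _ (cG i omega) _ e2; have := noise _ e2.
  apply: filterS2 => m h1 h2 a Wa.
  rewrite (_ : \sum_(j < m) _ = \sum_(j < m) F l a (X i j omega) * G i omega (X i j omega) +
     \sum_(j < m) F l a (X i j omega) * E i j omega); last first.
    by rewrite -big_split/=; apply: eq_bigr => j _; rewrite -mulrDr.
  rewrite mulrDl addrAC; apply: le_trans (ler_normD _ _) _; rewrite [eps]splitr.
  by apply: lerD; [exact: h2|exact: h1].
pose S := Borel (cont_on Z * 'rV[R]_o)%type.
pose f a : S -> R := (fun gt : cont_on Z * 'rV[R]_o => c gt.2 (H a gt.1)).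
pose GT0 : {mfun Omega >-> S} :=
  HB.pack (GT 0%N) (isMeasurableFun.Build _ _ _ _ (GT 0%N) (GT_measurable 0%N)).
pose nu : probability S R := distribution P GT0.
have law j B : measurable B -> P (GT j @^-1` B) = nu B by move=> mB; exact: GT_identical.
have mf a : W a -> measurable_fun setT (f a).
  by move=> Wa; exact: (loss_measurable Z_compact F_measurable iD F_bound U_unif_continuous c_continuous Wa).
have cf s : eps_delta_continuous_on W (f ^~ s).
  case: s => g t.
  exact: (loss_continuous_param Z_compact F_continuous F_measurable iD F_bound
    U_unif_continuous c_continuous t (@cont_on_continuous R u Z g)).
have f0 a s : 0 <= f a s by exact: c_ge0.
have fB a s : W a -> `|f a s| <= cmax (s : cont_on Z * 'rV[R]_o).2.
  by move=> Wa; rewrite ger0_norm//; exact: c_bound.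
have [env [menv env_le fenv]] := measurable_envelope W0 mf cf fB.
have env0 s : 0 <= env s by have /andP[] := env_le s.
(* Transported back to [Omega] by the law of [GT 0%N], the measurable envelope lies below [cmax] of
   [T 0%N], whose expectation is finite. *)
have ienv : nu.-integrable setT (EFin \o env).
  apply/integrableP; split; first exact/measurable_EFinP.
  under eq_integral => s _ do rewrite /= ger0_norm//.
  rewrite -(ge0_integral_law (GT_measurable 0%N) (law 0%N) (f := fun s => (env s)%:E))//; last first.
    exact/measurable_EFinP.
  have /integrableP[mcmax] := cmax_integrable; apply: le_lt_trans.
  apply: ge0_le_integral => //.
  - by move=> omega _; rewrite lee_fin.
  - apply/measurable_EFinP; exact: (measurableT_comp menv (GT_measurable 0%N)).
  - exact: measurableT_comp.
  - move=> omega _; rewrite /= lee_fin ger0_norm//.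
    by have /andP[] := env_le (GT 0%N omega).
pose lam a := \int[nu]_s f a s.
have clam : eps_delta_continuous_on W lam.
  exact: (dominated_Rintegral_continuous mf cf fenv ienv).
(* [Wstar] compares extended real expectations; on [W] these are finite and equal to [lam], so both
   orders give the same minimizers. *)
have WstarE : Wstar = minimizers W lam.
  have EE a : W a -> ('E_P[fun omega => c (T 0%N omega) (H a (G 0%N omega))] = (lam a)%:E)%E.
    move=> Wa; rewrite unlock /lam /Rintegral fineK; last first.
      by apply: integrable_fin_num => //; exact: (dominated_integrable_on mf fenv ienv).
    apply: (ge0_integral_law (GT_measurable 0%N) (law 0%N) (f := fun s => (f a s)%:E)) => //.
      by apply/measurable_EFinP; exact: mf.
    by move=> s; rewrite lee_fin.
  apply/seteqP; split => a [Wa ha]; split => // b Wb.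
    by rewrite -lee_fin -!EE//; exact: ha.
  by rewrite !EE// lee_fin; exact: ha.
have outer : {ae P, forall omega, forall eps : R, 0 < eps -> \forall n \near \oo, forall a, W a ->
    `|(\sum_(i < n) (f a (GT i omega) - lam a)) / n%:R| <= eps}.
  apply: (uniform_slln_identically_distributed GT_measurable law Wc mf cf fenv ienv).
  by move=> i j A B; exact: mutually_independent_pair.
apply: filterS2 inner outer => omega hin hout.
apply: limsup_sizes_cvg0 => [n m|eps eps0]; first exact: edist_inf_ge0.
have [eta eta0 heta] := near_minimizers Wc clam eps0.
(* One quarter goes to the features and one to the sample mean of the losses; the resulting
   [eta / 2] is paid twice, at the empirical minimizer and at its competitor. *)
have e4 : 0 < eta / 4 by rewrite divr_gt0.
have [N _ hN] := hout _ e4.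
exists (maxn N 1) => n; rewrite geq_max => /andP[Nn n0].
(* The threshold depends on [i] and on the realization but not on the parameter, since both the
   features and the loss are controlled uniformly over [W]. *)
have /choice[M hM] i : exists M, forall m, (M <= m)%N -> forall a, W a ->
    `|c (T i omega) (empirical_model F U m a (X i ^~ omega) (Y i ^~ omega)) -
      f a (GT i omega)| <= eta / 4.
  have [dl dl0 hdl] := loss_close_of_features U_unif_continuous c_continuous U_bounded (T i omega) e4.
  have dl2 : 0 < dl / 2 by rewrite divr_gt0.
  have [M _ hM] : \forall m \near \oo, forall l a, Wl (lift ord0 l) a ->
    `|(\sum_(j < m) F l a (X i j omega) * Y i j omega) / m%:R -
      \int[mu]_(x in Z) (F l a x * G i omega x)| <= dl / 2.
    by apply: filter_forall => l; exact: hin.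
  exists M => m Mm a Wa; apply: hdl; first exact: Wa.
  move=> l; rewrite !mxE mulrC; apply: le_lt_trans (hM m Mm l _ (Wa _)) _.
  by rewrite ltr_pdivrMr// mulr2n mulrDr mulr1 ltrDl.
(* With [n] fixed, a maximum over finitely many thresholds is available; the successor makes all
   sizes positive, as [w_minimizer] demands. *)
exists (\max_(i < n) (M i)).+1 => m hm.
have m_gt0 i : (i < n)%N -> (0 < m i)%N by move=> /hm; exact: leq_ltn_trans.
have Mm i : (i < n)%N -> (M i <= m i)%N.
  move=> iN; apply: leq_trans (hm i iN); apply: leqW.
  exact: (@leq_bigmax _ (fun i : 'I_n => M i) (Ordinal iN)).
have nR0 : 0 < n%:R :> R by rewrite ltr0n.
pose emp := empirical_error F U c n m (T ^~ omega) (fun i j => X i j omega) (fun i j => Y i j omega).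
have emp_close a : W a -> `|emp a - lam a| <= eta / 2.
  move=> Wa; have := hN n Nn a Wa.
  rewrite sumrB sumr_const card_ord mulrBl -(mulr_natr (lam a)) mulfK ?gt_eqF// => h.
  have h' : `|emp a - (\sum_(i < n) f a (GT i omega)) / n%:R| <= eta / 4.
    rewrite /emp /empirical_error mulrC -mulrBl -sumrB normrM normfV (gtr0_norm nR0) ler_pdivrMr//.
    apply: le_trans (ler_norm_sum _ _ _) _.
    apply: (@le_trans _ _ (\sum_(i < n) eta / 4)).
      by apply: ler_sum => i _; exact: (hM i (m i) (Mm i (ltn_ord i)) a Wa).
    by rewrite sumr_const card_ord mulr_natr.
  rewrite -(subrK ((\sum_(i < n) f a (GT i omega)) / n%:R) (emp a)) -addrA.
  apply: le_trans (ler_normD _ _) _; lra.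
have [Ww wmin] := w_minimizer n m omega n0 m_gt0.
have [|a amin wa] := heta _ Ww.
  move=> b Wb; have := wmin b Wb; rewrite -/emp => hb.
  have := emp_close _ Ww; have := emp_close _ Wb; rewrite !ler_norml => /andP[? ?] /andP[? ?].
  by move: hb; rewrite -/(emp _); lra.
apply: (@le_trans _ _ (edist (w n m omega, a))).
  by apply: ereal_inf_lbound; exists a => //; rewrite WstarE.
by apply: edist_fin => //=; rewrite mx_norm_ball.
Qed.
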